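(* Let $\{a_{ij}\}_{i,j=1}^n$ be an array of real numbers satisfying $\sum_{j=1}^n a_{ij}=0$ for all $i$ and $\sum_{i=1}^n a_{ij}=0$ for all $j$. Let $\pi$ be a uniform random permutation of $\{1,2,\ldots,n\}$, and set $c_0=\max_{i,j}|a_{ij}|$, $\sigma^2=E\bigl(\sum_{i=1}^n a_{i\pi(i)}\bigr)^2$ with $\sigma>0$, and $W=\sum_{i=1}^n a_{i\pi(i)}/\sigma$. Then $$\frac{P(W\ge x)}{1-\Phi(x)}=1+O(1)(1+x^3)\,c_0/\sigma$$ for $0\le x\le(\sigma/c_0)^{1/3}$.
   Context: $\Phi$ is the standard normal distribution function. $O(1)$ denotes a quantity whose absolute value is bounded by an absolute (universal) constant. *)

(* Defs.v *)
From HB Require Import structures.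
From mathcomp Require Import all_boot all_order all_algebra all_fingroup.
From mathcomp Require Import all_classical all_reals all_analysis.
Import Order.TTheory GRing.Theory Num.Theory.
Import numFieldNormedType.Exports.

Set Implicit Arguments.
Unset Strict Implicit.
Unset Printing Implicit Defensive.

Local Open Scope classical_set_scope.
Local Open Scope ring_scope.

Definition Phi (R : realType) (x : R) : R :=
  fine (normal_prob 0 1 `]-oo, x]).

(* Measurability of [pi] for the discrete sigma-algebra on the finite set 'S_n
   amounts to measurability of each event {pi = s}. *)
Definition uniform_random_perm (d : measure_display) (T : measurableType d)
    (R : realType) (P : probability T R) (n : nat) (pi : T -> 'S_n) : Prop :=
  forall s : 'S_n, measurable [set w | pi w = s] /\
    P [set w | pi w = s] = ((n`!)%:R^-1)%:E.

Definition perm_sum (R : realType) (n : nat) (a : 'M[R]_n) (s : 'S_n) : R :=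
  \sum_(i < n) a i (s i).

(* The base value 0 is harmless since the entries |a i j| are nonnegative; it
   only matters for the empty matrix. *)
Definition max_entry (R : realType) (n : nat) (a : 'M[R]_n) : R :=
  \big[Num.max/0]_(i < n) \big[Num.max/0]_(j < n) `|a i j|.

(* Main.v *)
Require Import Defs.
From HB Require Import structures.
From mathcomp Require Import all_boot all_order all_algebra all_fingroup.
From mathcomp Require Import all_classical all_reals all_analysis.
From mathcomp Require Import measurable_realfun ring lra.
Import Order.TTheory GRing.Theory Num.Theory.
Import numFieldNormedType.Exports.

Set Implicit Arguments.
Unset Strict Implicit.
Unset Printing Implicit Defensive.

Local Open Scope classical_set_scope.
Local Open Scope ring_scope.

(** Write W for the normalised permutation sum, c0 for the largest entry in
absolute value and d = 12 c0 / sigma.  The proof is Stein's method in its zero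
bias form, but it never solves the Stein equation.

The zero bias distribution of W is the law of a variable Z with
E[W F(W)] = E[F'(Z)]; it has density m(x) = E[W; W >= x] and tail
H(x) = E[W max(W - x, 0)], and the Gaussian is characterised by Z = W in law.
Composing s with a transposition of two positions gives an exchangeable pair,
hence an exact formula for the sum over s of S(s) F(S(s)) in terms of increments
of F, weighted by the increments of S, which depend only on the two positions and
their images (exchangeable_identity).
Prescribing the images of two positions moves S by at most 8 c0, and so Z can be
coupled to W with |Z - W| <= d.  Everything that follows uses only
E[W F(W)] <= E[F'(W + d)] for nondecreasing F', for W and for -W
(perm_zero_bias, perm_sum_zero_bias).

If Z were equal to W, then m would satisfy m(x) = E[Z; Z >= x], the integral
of u m(u) over u >= x, whose solutions are the multiples of exp(-x^2/2).  The
coupling gives instead L(x) <= m(x) <= L(x) + error, where L(x) is the integral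
of u m(u + d) over u >= x and the error is O(d) (H + x m) near x.  A crude
recursion in steps of d (profile_ratio) shows that m does not decrease by more
than a constant factor over a distance d, and x H(x + d) <= m(x) bounds H by m, so
that the relative error is O(d (1 + x)) (profile_defect).  In the variable x^2/2,
Gronwall's inequality then gives
m(x) = m(0) exp(-x^2/2) (1 + O(d (1 + x^3))), which is where the cube comes from
(profile_L_gaussian, profile_m_gaussian).

Integrating m from x to a cutoff b of order d^(-1/3) gives
H(x) = m(0) gtail(x) + O(d (1 + x^2)) exp(-x^2/2) (profile_H_gaussian).  The
unknown m(0) is found from this estimate at x = 0 for both W and -W, because the
two values of H add up to E[W^2] = 1 while m(0) is the same for both.  Finally
P(W >= x) lies between H(x + d) and H(x - d), and exp(-x^2/2) is at most a
constant times (1 + x) (1 - Phi(x)) (profile_moderate_deviation).  When d is not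
small, x is bounded and there is nothing to prove beyond 1 - Phi(x) > 0. *)

(** * Zero bias of permutation sums *)

(** F is a primitive of the nondecreasing function g.  Bounding the secant slopes
of F instead of differentiating it covers the step functions g that define tails. *)
Definition primitive_of (R : realType) (g F : R -> R) : Prop :=
  forall x y, x <= y -> (y - x) * g x <= F y - F x /\ F y - F x <= (y - x) * g y.

Lemma primitive_of_homo (R : realType) (g F : R -> R) :
  primitive_of g F -> {homo g : x y / x <= y}.
Proof.
move=> gF x y; rewrite le_eqVlt => /orP[/eqP->//|xy].
have [h1 h2] := gF _ _ (ltW xy).
by have := le_trans h1 h2; rewrite ler_pM2l // subr_gt0.
Qed.

Lemma perm_sumN (R : realType) (n : nat) (a : 'M[R]_n) (s : 'S_n) :
  perm_sum (- a) s = - perm_sum a s.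
Proof. by rewrite /perm_sum -sumrN; apply: eq_bigr => i _; rewrite mxE. Qed.

Lemma le_max_entry (R : realType) (n : nat) (a : 'M[R]_n) i j :
  `|a i j| <= max_entry a.
Proof.
apply: le_trans (le_bigmax _ (fun i => \big[Num.max/0]_j `|a i j|) i).
exact: (le_bigmax _ (fun j => `|a i j|) j).
Qed.

Lemma max_entryN (R : realType) (n : nat) (a : 'M[R]_n) :
  max_entry (- a) = max_entry a.
Proof.
by rewrite /max_entry; apply: eq_bigr => i _; apply: eq_bigr => j _;
  rewrite mxE normrN.
Qed.

(** Only the two rows that s sends to p or to q are affected, each by a difference
of two entries. *)
Lemma perm_sum_tperm (R : realType) (n : nat) (a : 'M[R]_n) (s : 'S_n) p q :
  `|perm_sum a (s * tperm p q) - perm_sum a s| <= 4 * max_entry a.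
Proof.
have c_ge0 : 0 <= max_entry a by apply: bigmax_ge_id.
rewrite /perm_sum -sumrB.
apply: le_trans (ler_norm_sum _ _ _) _.
pose c := max_entry a.
have one r : \sum_(i < n) (2 * c *+ (s i == r)) = 2 * c.
  rewrite (reindex_inj (@perm_inj _ s^-1)) (bigD1 r) //= permKV eqxx mulr1n.
  by rewrite big1 ?addr0 // => i ir; rewrite permKV (negbTE ir).
apply: (@le_trans _ _ (\sum_(i < n) (2 * c *+ (s i == p) + 2 * c *+ (s i == q)))).
  apply: ler_sum => i _; rewrite permM.
  have bnd k : `|a i k - a i (s i)| <= 2 * c.
    apply: le_trans (ler_normB _ _) _.
    have := le_max_entry a i k; have := le_max_entry a i (s i); rewrite -/c; lra.
  case: tpermP => [e|e|/eqP/negbTE-> /eqP/negbTE->].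
  - have:= bnd q; rewrite e eqxx => /le_trans; apply.
    by rewrite lerDl mulrn_wge0 // mulr_ge0.
  - have:= bnd p; rewrite e eqxx => /le_trans; apply.
    by rewrite lerDr mulrn_wge0 // mulr_ge0.
  - by rewrite subrr normr0 addr0.
by rewrite big_split /= !one; rewrite -/c; lra.
Qed.

Lemma tperm_mul_perm (n : nat) (s : 'S_n) i j :
  (tperm i j * s = s * tperm (s i) (s j))%g.
Proof. by rewrite -tpermJ /conjg !mulgA mulgV mul1g. Qed.

(** The permutation s * tperm (s i) k sends i to k, and each permutation sending i
to k arises from n permutations s, one for each value of s i.  This couples a
uniform permutation with one conditioned on the image of i. *)
Lemma sum_perm_fix1 (R : realType) (n : nat) (h : 'S_n -> R) (i k : 'I_n) :
  \sum_(s : 'S_n) h (s * tperm (s i) k)%g = n%:R * \sum_(s : 'S_n | s i == k) h s.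
Proof.
rewrite (partition_big (fun s : 'S_n => s i) xpredT) //=.
rewrite (eq_bigr (fun=> \sum_(s : 'S_n | s i == k) h s)); last first.
  move=> p _; rewrite (reindex_inj (mulIg (tperm p k))) /=.
  apply: eq_big => s.
    by rewrite /= permM (inv_eq (tpermK p k)) tpermL.
  by move=> /eqP ->; rewrite -mulgA tperm2 mulg1.
by rewrite sumr_const card_ord mulr_natl.
Qed.

(** Prescribing the image of j does not disturb that of i, because k is neither l
nor the former image of j. *)
Lemma sum_perm_fix2 (R : realType) (n : nat) (h : 'S_n -> R) (i j k l : 'I_n) :
  i != j -> k != l ->
  \sum_(s : 'S_n | s i == k) h (s * tperm (s j) l)%g =
  (n%:R - 1) * \sum_(s : 'S_n | (s i == k) && (s j == l)) h s.
Proof.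
move=> ij kl.
rewrite (partition_big (fun s : 'S_n => s j) (predC1 k)) /=; last first.
  by move=> s /eqP <-; rewrite (inj_eq perm_inj) eq_sym.
rewrite (eq_bigr (fun=> \sum_(s : 'S_n | (s i == k) && (s j == l)) h s)); last first.
  move=> q qk; rewrite (reindex_inj (mulIg (tperm q l))) /=.
  have tk : tperm q l k = k by rewrite tpermD // eq_sym.
  apply: eq_big => s.
    by rewrite /= !permM !(inv_eq (tpermK q l)) tk tpermL.
  by move=> /andP[_ /eqP ->]; rewrite -mulgA tperm2 mulg1.
rewrite sumr_const -[LHS]mulr_natl; congr (_ * _).
have -> : #|predC1 k| = n.-1 by rewrite cardC1 card_ord.
by case: n i j k l h ij kl => [[]//|n *]; rewrite /= -natr1 addrK.
Qed.

(** The two successive couplings move perm_sum a by at most 8 max_entry a. *)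
Lemma sum_perm_fixed_le (R : realType) (n : nat) (a : 'M[R]_n) (g : R -> R)
    (i j k l : 'I_n) (t : R) :
  {homo g : x y / x <= y} -> i != j -> k != l ->
  n%:R * (n%:R - 1) *
    \sum_(s : 'S_n | (s i == k) && (s j == l)) g (perm_sum a s + t) <=
  \sum_(s : 'S_n) g (perm_sum a s + (8 * max_entry a + t)).
Proof.
move=> gh ij kl.
rewrite -mulrA -(sum_perm_fix2 _ ij kl) -(@sum_perm_fix1 _ _
  (fun s => g (perm_sum a (s * tperm (s j) l)%g + t))).
apply: ler_sum => s _; apply: gh.
set u := (s * tperm (s i) k)%g.
have := perm_sum_tperm a u (u j) l; have := perm_sum_tperm a s (s i) k.
by rewrite -/u !ler_norml => /andP[_ h1] /andP[_ h2]; lra.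
Qed.

(** The change of the permutation sum when i and j, mapped to k and l, exchange
their images. *)
Definition swap_gain (R : realType) (n : nat) (a : 'M[R]_n) (i j k l : 'I_n) : R :=
  a i l + a j k - a i k - a j l.

Lemma perm_sum_swap (R : realType) (n : nat) (a : 'M[R]_n) (s : 'S_n) i j :
  perm_sum a (tperm i j * s)%g - perm_sum a s = swap_gain a i j (s i) (s j).
Proof.
have [<-|ij] := eqVneq i j.
  by rewrite tperm1 mul1g subrr /swap_gain; ring.
rewrite /perm_sum (bigD1 i) //= (bigD1 j) /=; last by rewrite eq_sym.
rewrite [X in _ - X](bigD1 i) //= [X in _ - (_ + X)](bigD1 j) /=; last by rewrite eq_sym.
rewrite (eq_bigr (fun k => a k (s k))); last first.
  by move=> k /andP[ki kj]; rewrite permM tpermD // eq_sym.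
by rewrite !permM tpermL tpermR /swap_gain; ring.
Qed.

Lemma sum_swap_gain (R : realType) (n : nat) (a : 'M[R]_n) (s : 'S_n) :
  (forall i : 'I_n, \sum_(j < n) a i j = 0) ->
  (forall j : 'I_n, \sum_(i < n) a i j = 0) ->
  \sum_(i < n) \sum_(j < n) swap_gain a i j (s i) (s j) = - (2 * n%:R * perm_sum a s).
Proof.
move=> ra ca.
have -> : \sum_(i < n) \sum_(j < n) swap_gain a i j (s i) (s j) =
  \sum_(i < n) (- (n%:R * a i (s i)) - perm_sum a s).
  apply: eq_bigr => i _; rewrite /swap_gain !sumrB big_split /=.
  have -> : \sum_(j < n) a i (s j) = 0.
    by rewrite -[RHS](ra i) [RHS](reindex_inj (@perm_inj _ s)).
  by rewrite ca sumr_const card_ord mulr_natl addr0 sub0r.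
by rewrite sumrB sumrN -mulr_sumr sumr_const card_ord -[perm_sum a s *+ n]mulr_natl /perm_sum; ring.
Qed.

(** For fixed i and j the map s |-> tperm i j * s is an involution that changes
the sign of swap_gain, and the total gain over i and j is linear in perm_sum by
sum_swap_gain. *)
Lemma exchangeable_identity (R : realType) (n : nat) (a : 'M[R]_n) (F : R -> R) :
  (forall i : 'I_n, \sum_(j < n) a i j = 0) ->
  (forall j : 'I_n, \sum_(i < n) a i j = 0) ->
  4 * n%:R * \sum_(s : 'S_n) perm_sum a s * F (perm_sum a s) =
  \sum_(i < n) \sum_(j < n) \sum_(s : 'S_n)
    swap_gain a i j (s i) (s j) *
    (F (perm_sum a (tperm i j * s)%g) - F (perm_sum a s)).
Proof.
move=> ra ca; set S := perm_sum a.
have step i j : \sum_(s : 'S_n) swap_gain a i j (s i) (s j) *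
    (F (S (tperm i j * s)%g) - F (S s)) =
    - 2 * \sum_(s : 'S_n) swap_gain a i j (s i) (s j) * F (S s).
  under eq_bigr do rewrite mulrBr.
  rewrite sumrB (reindex_inj (mulgI (tperm i j))) /=.
  rewrite (eq_bigr (fun s : 'S_n => - (swap_gain a i j (s i) (s j) * F (S s)))).
    by rewrite sumrN; ring.
  move=> s _; rewrite mulgA tperm2 mul1g !permM tpermL tpermR /swap_gain; ring.
under [RHS]eq_bigr => i _ do under eq_bigr => j _ do rewrite step.
under [RHS]eq_bigr do rewrite -mulr_sumr exchange_big /=.
rewrite -mulr_sumr exchange_big /= !mulr_sumr; apply: eq_bigr => s _.
under eq_bigr do rewrite -mulr_suml.
rewrite -mulr_suml sum_swap_gain // -/S; ring.
Qed.

(** The weights swap_gain ^+ 2 depend only on i, j and their images, and they vanish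
when i = j or k = l; otherwise sum_perm_fixed_le removes the conditioning on the
images.  The case g = 1 identifies the total weight. *)
Lemma perm_zero_bias (R : realType) (n : nat) (a : 'M[R]_n) (g F : R -> R) :
  (forall i : 'I_n, \sum_(j < n) a i j = 0) ->
  (forall j : 'I_n, \sum_(i < n) a i j = 0) -> (1 < n)%N ->
  primitive_of g F ->
  n`!%:R * \sum_(s : 'S_n) perm_sum a s * F (perm_sum a s) <=
  (\sum_(s : 'S_n) perm_sum a s ^+ 2) *
    \sum_(s : 'S_n) g (perm_sum a s + 12 * max_entry a).
Proof.
move=> ra ca n1 gF; set S := perm_sum a; set c := max_entry a.
have gh := primitive_of_homo gF.
pose D i j k l := swap_gain a i j k l.
pose V := \sum_(i < n) \sum_(j < n) \sum_(k < n) \sum_(l < n) D i j k l ^+ 2.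
have split_sum (f : R -> R) : \sum_(i < n) \sum_(j < n) \sum_(s : 'S_n)
    D i j (s i) (s j) ^+ 2 * f (S s) = \sum_(i < n) \sum_(j < n)
    \sum_(k < n) \sum_(l < n) D i j k l ^+ 2 *
      \sum_(s : 'S_n | (s i == k) && (s j == l)) f (S s).
  apply: eq_bigr => i _; apply: eq_bigr => j _.
  rewrite (partition_big (fun s : 'S_n => s i) xpredT) //=; apply: eq_bigr => k _.
  rewrite (partition_big (fun s : 'S_n => s j) xpredT) //=; apply: eq_bigr => l _.
  by rewrite mulr_sumr; apply: eq_bigr => s /andP[/eqP-> /eqP->].
have diag i j k l : (i == j) || (k == l) -> D i j k l = 0.
  by rewrite /D /swap_gain => /orP[]/eqP ->; ring.
have nn_gt0 : 0 < n%:R * (n%:R - 1) :> R.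
  by rewrite mulr_gt0 ?ltr0n ?subr_gt0 ?ltr1n // ltnW.
have fixed f t : {homo f : x y / x <= y} ->
  n%:R * (n%:R - 1) * (\sum_(i < n) \sum_(j < n)
    \sum_(s : 'S_n) D i j (s i) (s j) ^+ 2 * f (S s + t)) <=
  V * \sum_(s : 'S_n) f (S s + (8 * c + t)).
  move=> fh; rewrite (split_sum (fun x => f (x + t))) /V mulr_sumr mulr_suml; apply: ler_sum => i _.
  rewrite mulr_sumr mulr_suml; apply: ler_sum => j _.
  rewrite mulr_sumr mulr_suml; apply: ler_sum => k _.
  rewrite mulr_sumr mulr_suml; apply: ler_sum => l _.
  have [/diag ->|] := boolP ((i == j) || (k == l)).
    by rewrite expr0n /= !mul0r mulr0.
  rewrite negb_or => /andP[ij kl]; rewrite mulrCA.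
  by rewrite ler_wpM2l ?sqr_ge0 // sum_perm_fixed_le.
have VE : V * n`!%:R = n%:R * (n%:R - 1) * (4 * n%:R * \sum_(s : 'S_n) S s ^+ 2).
  have idE : 4 * n%:R * \sum_(s : 'S_n) S s ^+ 2 = \sum_(i < n) \sum_(j < n)
      \sum_(s : 'S_n) D i j (s i) (s j) ^+ 2 * 1.
    under eq_bigr do rewrite expr2.
    rewrite (exchangeable_identity id ra ca).
    apply: eq_bigr => i _; apply: eq_bigr => j _; apply: eq_bigr => s _.
    by rewrite perm_sum_swap mulr1 expr2.
  have cardE : \sum_(s : 'S_n) (1 : R) = n`!%:R.
    by rewrite sumr_const -card_Sn.
  have h1 := @fixed (fun=> 1) 0 (fun _ _ _ => lexx _).
  have h2 := @fixed (fun=> -1) 0 (fun _ _ _ => lexx _).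
  move: h1 h2; rewrite -idE cardE => h1.
  rewrite sumrN cardE (_ : \sum_(i < n) _ = - (4 * n%:R * \sum_(s : 'S_n) S s ^+ 2)).
    by rewrite !mulrN lerN2 => h2; apply/eqP; rewrite eq_le h1 h2.
  rewrite idE -sumrN; apply: eq_bigr => i _; rewrite -sumrN; apply: eq_bigr => j _.
  by rewrite -sumrN; apply: eq_bigr => s _; rewrite mulrN.
have main : 4 * n%:R * \sum_(s : 'S_n) S s * F (S s) <= \sum_(i < n) \sum_(j < n)
    \sum_(s : 'S_n) D i j (s i) (s j) ^+ 2 * g (S s + 4 * c).
  rewrite (exchangeable_identity F ra ca).
  apply: ler_sum => i _; apply: ler_sum => j _; apply: ler_sum => s _.
  rewrite -/S -/(D i j (s i) (s j)).
  have E := perm_sum_swap a s i j; rewrite -/S -/(D i j (s i) (s j)) in E.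
  have B := perm_sum_tperm a s (s i) (s j); rewrite -tperm_mul_perm -/S E in B.
  rewrite -E in B *; set S' := S _ in B *.
  move: B; rewrite ler_norml -/c => /andP[B1 B2].
  have [le|/ltW le] := leP (S s) S'.
    have [_ h] := gF _ _ le.
    apply: le_trans (ler_wpM2l _ h) _; first by rewrite subr_ge0.
    rewrite mulrA -expr2 ler_wpM2l ?sqr_ge0 //; apply: gh; lra.
  have [_ h] := gF _ _ le.
  rewrite -[F _ - _]opprB -[S' - _]opprB mulrNN sqrrN.
  apply: le_trans (ler_wpM2l _ h) _; first by rewrite subr_ge0.
  rewrite mulrA -expr2 ler_wpM2l ?sqr_ge0 //; apply: gh.
  by rewrite lerDl mulr_ge0 //; exact: bigmax_ge_id.
have n_gt0 : 0 < n%:R :> R by rewrite ltr0n ltnW.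
rewrite -(ler_pM2l nn_gt0) -(ler_pM2l n_gt0) -(@ler_pM2l _ 4) //.
set X := \sum_s _ * _ in main *; set Y := \sum_s _ ^+ 2 in VE *.
have fact_ge0 : 0 <= n`!%:R :> R by [].
have h := ler_wpM2l fact_ge0 (le_trans (ler_wpM2l (ltW nn_gt0) main) (fixed g _ gh)).
have -> : 4 * (n%:R * (n%:R * (n%:R - 1) * (n`!%:R * X))) =
  n`!%:R * (n%:R * (n%:R - 1) * (4 * n%:R * X)) by ring.
apply: le_trans h _.
have -> : 8 * c + 4 * c = 12 * c by ring.
rewrite [_ * (V * _)]mulrCA [V * _]mulrA VE.
by rewrite le_eqVlt; apply/orP; left; apply/eqP; ring.
Qed.

(** * Functions with controlled increments *)

(** Cutting [a, b] into N equal pieces makes the total increment at most a constant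
times N * N^-2. *)
Lemma le_of_quadratic_increments (R : realType) (f : R -> R) (a b M eta : R) :
  a <= b -> 0 <= M -> 0 < eta ->
  (forall s t, a <= s -> s <= t -> t <= b -> t - s <= eta ->
     f t - f s <= M * (t - s) ^+ 2) ->
  f b <= f a.
Proof.
move=> ab M0 eta0 hf; rewrite leNgt; apply/negP => fab.
have e0 : 0 < f b - f a by rewrite subr_gt0.
pose B := (b - a) / eta + M * (b - a) ^+ 2 / (f b - f a).
have B1 : 0 <= (b - a) / eta by rewrite divr_ge0 ?subr_ge0 // ltW.
have B2 : 0 <= M * (b - a) ^+ 2 / (f b - f a).
  by apply: divr_ge0 (ltW e0); rewrite mulr_ge0 ?sqr_ge0.
have B0 : 0 <= B by rewrite addr_ge0.
pose N := (Num.truncn B).+1.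
have BN : B < N%:R by have /andP[_] := truncn_itv B0.
have N0 : 0 < N%:R :> R by rewrite ltr0n.
pose h := (b - a) / N%:R.
have h0 : 0 <= h by rewrite divr_ge0 ?subr_ge0 // ltW.
have hN : h * N%:R = b - a by rewrite /h mulfVK // gt_eqF.
have step k : (k <= N)%N -> f (a + k%:R * h) - f a <= k%:R * (M * h ^+ 2).
  elim: k => [|k IH kN]; first by rewrite !mul0r addr0 subrr.
  have kh : k.+1%:R * h <= b - a by rewrite -hN mulrC ler_wpM2l // ler_nat.
  have /hf : a <= a + k%:R * h by rewrite lerDl mulr_ge0.
  move=> /(_ (a + k.+1%:R * h)) /[!(lerD2l, ler_wpM2r, ler_nat)] //.
  have -> : a + k.+1%:R * h - (a + k%:R * h) = h by rewrite -natr1; ring.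
  rewrite addrC -lerBrDr => /(_ isT kh) H.
  have /H {}H : h <= eta.
    rewrite /h ler_pdivrMr // mulrC -ler_pdivrMr //; apply: le_trans (ltW BN).
    by rewrite /B lerDl.
  move: H (IH (ltnW kN)); set X := f (a + k.+1%:R * h).
  have -> : k.+1%:R = k%:R + 1 :> R by rewrite natr1.
  lra.
have := step N (leqnn _); rewrite [N%:R * h]mulrC hN [a + _]addrC subrK.
rewrite leNgt => /negP; apply.
have -> : N%:R * (M * h ^+ 2) = M * (b - a) ^+ 2 / N%:R.
  by rewrite /h; field; rewrite gt_eqF.
rewrite ltr_pdivrMr // [ltRHS]mulrC -ltr_pdivrMr //; apply: le_lt_trans BN.
by rewrite /B lerDr.
Qed.

(** The function f t * expR (k * t) decreases at most quadratically, because
(1 - y) * expR y >= 1 - y ^+ 2.  A positive k gives a lower bound of the decay of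
f, a negative k of its growth. *)
Lemma gronwall_lower (R : realType) (f : R -> R) (k T B : R) :
  0 <= T -> (forall s, 0 <= s -> s <= T -> 0 <= f s /\ f s <= B) ->
  (forall s t, 0 <= s -> s <= t -> t <= T -> f s * (1 - k * (t - s)) <= f t) ->
  f 0 * expR (- k * T) <= f T.
Proof.
move=> T0 fB hf.
have B0 : 0 <= B by have [h1 h2] := fB _ (lexx 0) T0; exact: le_trans h2.
suff: - (f T * expR (k * T)) <= - (f 0 * expR (k * 0)).
  rewrite lerN2 mulr0 expR0 mulr1 => h.
  by rewrite mulNr expRN ler_pdivrMr ?expR_gt0.
apply: (@le_of_quadratic_increments _ (fun t => - (f t * expR (k * t))) 0 T
  (B * expR (`|k| * T) * k ^+ 2) (1 + `|k|)^-1) => //.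
  by rewrite mulr_ge0 ?sqr_ge0 // mulr_ge0 ?expR_ge0.
move=> s t s0 st tT ts /=.
have [fs0 fsB] := fB _ s0 (le_trans st tT).
set y := k * (t - s).
have y1 : y <= 1.
  apply: (@le_trans _ _ (`|k| * (1 + `|k|)^-1)).
    apply: (@le_trans _ _ (`|k| * (t - s))).
      by rewrite ler_wpM2r ?subr_ge0 // ler_norm.
    by rewrite ler_wpM2l.
  by rewrite ler_pdivrMr ?mul1r ?lerDr // -[ltLHS]addr0 ltr_leD.
have ekt : expR (k * t) = expR (k * s) * expR y.
  by rewrite -expRD; congr expR; rewrite /y; ring.
have E : (1 - y ^+ 2) <= (1 - y) * expR y.
  have -> : 1 - y ^+ 2 = (1 - y) * (1 + y) by ring.
  by rewrite ler_wpM2l ?subr_ge0 // expR_ge1Dx.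
have h1 : f s * expR (k * s) * (1 - y ^+ 2) <= f t * expR (k * t).
  apply: (@le_trans _ _ (f s * expR (k * s) * ((1 - y) * expR y))).
    by rewrite ler_wpM2l // mulr_ge0 ?expR_ge0.
  have -> : f s * expR (k * s) * ((1 - y) * expR y) = f s * (1 - y) * expR (k * t).
    by rewrite ekt; ring.
  by rewrite ler_wpM2r ?expR_ge0 // hf.
have h2 : f s * expR (k * s) <= B * expR (`|k| * T).
  apply: ler_pM; rewrite ?expR_ge0 //.
  rewrite ler_expR (le_trans (ler_norm _)) // normrM ler_wpM2l //.
  by rewrite ger0_norm // (le_trans st).
have h3 : f s * expR (k * s) * y ^+ 2 <= B * expR (`|k| * T) * y ^+ 2.
  by rewrite ler_wpM2r ?sqr_ge0.
have -> : B * expR (`|k| * T) * k ^+ 2 * (t - s) ^+ 2 =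
  B * expR (`|k| * T) * y ^+ 2 by rewrite /y; ring.
lra.
Qed.

(** A one-sided fundamental theorem of calculus for a function F that need not be
differentiable, such as the tail of a discrete law. *)
Lemma integrate_increments (R : realType) (F Psi g dg : R -> R) (a b M K : R) :
  a <= b -> 0 <= M -> 0 <= K ->
  (forall x : R, is_derive x 1 Psi (g x)) ->
  (forall x : R, is_derive x 1 g (dg x)) ->
  (forall x, a <= x -> x <= b -> `|dg x| <= M) ->
  (forall s t, a <= s -> s <= t -> t <= b ->
     F t - F s <= (t - s) * g s + K * (t - s) ^+ 2) ->
  F b - F a <= Psi b - Psi a.
Proof.
move=> ab M0 K0 dPsi dgg gM hF.
suff : F b - Psi b <= F a - Psi a by lra.
apply: (@le_of_quadratic_increments _ (fun x => F x - Psi x) a b (M + K) 1) => //.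
  by rewrite addr_ge0.
move=> s t sa st tb _ /=.
have cts (f df : R -> R) (x y : R) : (forall x : R, is_derive x 1 f (df x)) ->
    {within `[x, y], continuous f}.
  move=> fdf; apply: derivable_within_continuous => z _.
  by have [] := fdf z.
have [c] := MVT_segment st (fun x _ => dPsi x) (cts _ _ s t dPsi).
rewrite in_itv /= => /andP[sc ct] Ec.
have [e] := MVT_segment sc (fun x _ => dgg x) (cts _ _ s c dgg).
rewrite in_itv /= => /andP[se ec] Ee.
have := gM e (le_trans sa se) (le_trans ec (le_trans ct tb)).
rewrite ler_norml => /andP[ge1 _].
have := hF _ _ sa st tb.
have : g s - M * (t - s) <= g c.
  have : - M * (t - s) <= dg e * (c - s).
    apply: (@le_trans _ _ (- M * (c - s))); last by rewrite ler_wpM2r ?subr_ge0.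
    by rewrite !mulNr lerN2 ler_wpM2l // lerB.
  lra.
move=> /(ler_wpM2l (_ : 0 <= t - s)) -/(_ ltac:(lra)); nra.
Qed.

(** * The Gaussian tail *)

(** The Gaussian density without its normalising factor. *)
Definition psi (R : realType) (u : R) : R := expR (- (u ^+ 2 / 2)).

Lemma psi_gt0 (R : realType) (u : R) : 0 < psi u.
Proof. exact: expR_gt0. Qed.

Lemma psi_nonincr (R : realType) (s t : R) : 0 <= s -> s <= t -> psi t <= psi s.
Proof.
move=> s0 st; rewrite /psi ler_expR lerN2 ler_pM2r //.
by rewrite lerXn2r // nnegrE (le_trans s0).
Qed.

Lemma normal_pdfE01 (R : realType) (u : R) : normal_pdf 0 1 u = normal_peak 1 * psi u.
Proof.
rewrite normal_pdfE ?oner_neq0 // /normal_fun /psi subr0 expr1n mulNr.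
by rewrite mulr2n.
Qed.

Lemma normal_probE01 (R : realType) (x y : R) : x <= y ->
  normal_prob (0:R) 1 `]x, y] = (Phi y - Phi x)%:E.
Proof.
move=> xy.
have fin z : normal_prob (0:R) 1 `]-oo, z] \is a fin_num.
  exact: fin_num_measure.
rewrite /Phi EFinB !fineK //.
have -> : `]-oo, y]%classic = `]-oo, x]%classic `|` `]x, y]%classic.
  by rewrite -itv_bndbnd_setU.
rewrite [normal_prob _ _ (_ `|` _)]measureU //; first by rewrite addeAC subee ?add0e //; exact: fin.
by apply/seteqP; split => // z [] /=; rewrite !in_itv /= => zx /andP[]; rewrite ltNge zx.
Qed.

Lemma Phi_increment (R : realType) (x y : R) : 0 <= x -> x <= y ->
  (y - x) * (normal_peak 1 * psi y) <= Phi y - Phi x /\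
  Phi y - Phi x <= (y - x) * (normal_peak 1 * psi x).
Proof.
move=> x0 xy; rewrite -!lee_fin -normal_probE01 // /normal_prob.
have cst (c : R) : (\int[lebesgue_measure]_(u in `]x, y]) c%:E)%E = ((y - x) * c)%:E.
  rewrite integral_cst //= lebesgue_measure_itv /= lte_fin.
  case: ltP => [_|yx]; first by rewrite -EFinB -EFinM mulrC.
  by rewrite mule0 (_ : y = x) ?subrr ?mul0r //; apply/eqP; rewrite eq_le xy yx.
have pk : 0 <= normal_peak 1 :> R by exact: normal_peak_ge0.
rewrite -!cst; split; apply: ge0_le_integral => //=.
- by move=> u _; rewrite lee_fin mulr_ge0 // ltW // psi_gt0.
- by apply/measurable_EFinP; apply: measurable_funTS; exact: measurable_normal_pdf.
- move=> u; rewrite in_itv /= => /andP[xu uy].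
  by rewrite lee_fin normal_pdfE01 ler_wpM2l // psi_nonincr // (le_trans x0) // ltW.
- by move=> u _; rewrite lee_fin normal_pdf_ge0.
- by apply/measurable_EFinP; apply: measurable_funTS; exact: measurable_normal_pdf.
- move=> u; rewrite in_itv /= => /andP[xu uy].
  by rewrite lee_fin normal_pdfE01 ler_wpM2l // psi_nonincr // ltW.
Qed.

(** The density is even and has total mass 1. *)
Lemma Phi0 (R : realType) : Phi (0 : R) = 2^-1.
Proof.
have E1 : (\int[lebesgue_measure]_u (normal_pdf (0:R) 1 u)%:E = 1)%E.
  exact: integral_normal_pdf.
have pdf_even : normal_pdf (0:R) 1 =1 normal_pdf 0 1 \o -%R.
  by move=> u /=; rewrite !normal_pdfE01 /psi sqrrN.
rewrite ge0_symfun_integralT // in E1; last 2 first.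
- by move=> u; exact: normal_pdf_ge0.
- by apply: continuous_normal_pdf; rewrite oner_neq0.
have E2 : normal_prob (0:R) 1 [set x | 0 <= x] = (2^-1)%:E.
  rewrite /normal_prob; move: E1.
  case: (integral _ _ _) => [r| |] //=; last 2 first.
  - by rewrite mulry gtr0_sg // mul1e.
  - by rewrite mulrNy gtr0_sg // mul1e.
  rewrite -EFinM => -[E]; congr EFin.
  by rewrite -[r](mulKf (_ : 2 != 0)) ?E ?mulr1.
have E3 : normal_prob (0:R) 1 [set 0] = 0.
  rewrite /normal_prob; apply: null_set_integral => //=; last exact: lebesgue_measure_set1.
  by apply/measurable_EFinP; apply: measurable_funTS; exact: measurable_normal_pdf.
rewrite /Phi.
have -> : `]-oo, 0]%classic = ~` [set x | 0 <= x] `|` [set (0:R)].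
  apply/seteqP; split => x /=; rewrite in_itv /=.
    by rewrite le_eqVlt => /orP[/eqP ->|x0]; [right|left; apply/negP; rewrite -ltNge].
  by move=> [/negP|->//]; rewrite -ltNge => /ltW.
have m0 : measurable [set x : R | 0 <= x] by rewrite -set_itvcy.
have E4 : normal_prob (0:R) 1 (~` [set x | 0 <= x]) = (1 - 2^-1)%:E.
  have := @probability_setC _ _ _ (normal_prob (0:R) 1) _ m0.
  by rewrite [X in _ = (1 - X)%E]E2.
have E5 : normal_prob (0:R) 1 (~` [set x | 0 <= x] `|` [set 0]) =
    (normal_prob 0%R 1 (~` [set x | 0 <= x]%R) + normal_prob 0%R 1 [set 0%R])%E.
  apply: measureU => //; first exact: measurableC.
  by apply/seteqP; split => // x [] /= h x0; apply: h; rewrite x0.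
by rewrite E5 E3 E4 adde0 /=; field.
Qed.

Lemma Phi_tail (R : realType) (e : R) : 0 < e ->
  exists n : nat, 1 - Phi (n%:R : R) <= e.
Proof.
move=> e0.
have : normal_prob (0:R) 1 `]-oo, n%:R]%classic @[n --> \oo] --> (1%:E : \bar R).
  rewrite -(probability_setT (normal_prob (0:R) 1)).
  have <- : \bigcup_n `]-oo, (n%:R : R)]%classic = setT.
    rewrite -subTset => t _ /=.
    by exists (Num.truncn t).+1; rewrite //= in_itv /= ltW // truncnS_gt.
  apply: nondecreasing_cvg_mu => //; first exact: bigcup_measurable.
  move=> n m nm; apply/subsetPset => x /=; rewrite !in_itv /= => /le_trans.
  by apply; rewrite ler_nat.
move=> /fine_cvg /cvgrPdist_le /(_ _ e0) [n _ /(_ n (leqnn n))] h.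
by exists n; apply: le_trans h; rewrite ler_norm.
Qed.

Lemma Phi_le1 (R : realType) (x : R) : Phi x <= 1.
Proof.
have := @probability_le1 _ _ _ (normal_prob (0:R) 1) `]-oo, x] ltac:(exact: measurable_itv).
by rewrite /Phi -lee_fin fineK // fin_num_measure.
Qed.

Lemma is_derive_poly_psi (R : realType) (p : {poly R}) (x : R) :
  is_derive x 1 (fun u => p.[u] * psi u) ((p^`() - 'X * p).[x] * psi x).
Proof.
have -> : (fun u => p.[u] * psi u) =
    horner p * (expR \o horner (- 2^-1 *: 'X^2)).
  apply/funext => u; rewrite /psi !fctE /= !hornerE.
  by congr (_ * expR _); rewrite /=; field.
have h1 := @is_derive1_comp R expR (horner (- 2^-1 *: 'X^2)) x _ _
  (is_derive_expR _) (is_derive_poly (- 2^-1 *: 'X^2) x).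
apply: (@is_derive_eq _ _ _ _ _ _ _ _ (is_deriveM (is_derive_poly p x) h1)).
have hx : (- 2^-1 *: 'X^2 : {poly R}).[x] = - (x ^+ 2 / 2).
  by rewrite !hornerE /=; field.
rewrite /psi /= hx; set e := expR _.
by rewrite !poly.derivE !hornerE /GRing.scale /=; field.
Qed.

Lemma poly_psi_lipschitz (R : realType) (p : {poly R}) (a b : R) :
  exists2 K, 0 <= K & forall s t, a <= s -> s <= t -> t <= b ->
    `|p.[t] * psi t - p.[s] * psi s| <= K * (t - s).
Proof.
pose q := p^`() - 'X * p.
have [K qK] := poly_itv_bound q a b.
exists `|K| => // s t sa st tb.
have [|c] := MVT_segment st (fun x _ => is_derive_poly_psi p x).
  by apply: derivable_within_continuous => z _; have [] := is_derive_poly_psi p z.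
rewrite in_itv /= => /andP[sc ct] ->.
rewrite normrM (ger0_norm (_ : 0 <= t - s)) ?subr_ge0 // ler_wpM2r ?subr_ge0 //.
rewrite normrM (ger0_norm (ltW (psi_gt0 c))) -[leRHS]mulr1.
apply: ler_pM => //; first exact: ltW (psi_gt0 c).
  by apply: le_trans (ler_norm K); apply: qK; rewrite (le_trans sa sc) (le_trans ct tb).
by rewrite /psi -expR0 ler_expR oppr_le0 divr_ge0 // sqr_ge0.
Qed.

(** The function - p psi is a primitive of ('X * p - p^`()) psi. *)
Lemma integrate_poly_psi (R : realType) (F : R -> R) (p : {poly R}) (a b K : R) :
  a <= b -> 0 <= K ->
  (forall s t, a <= s -> s <= t -> t <= b ->
     F t - F s <= (t - s) * (('X * p - p^`()).[s] * psi s) + K * (t - s) ^+ 2) ->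
  F b - F a <= p.[a] * psi a - p.[b] * psi b.
Proof.
move=> ab K0 hF; pose q := 'X * p - p^`().
have [M qM] := poly_itv_bound (q^`() - 'X * q) a b.
pose Psi u := (- p).[u] * psi u.
have -> : p.[a] * psi a - p.[b] * psi b = Psi b - Psi a.
  by rewrite /Psi !hornerE; ring.
apply: (@integrate_increments _ F Psi (fun u => q.[u] * psi u)
  (fun u => (q^`() - 'X * q).[u] * psi u) a b `|M| K) => //.
- move=> x; have := is_derive_poly_psi (- p) x.
  by rewrite derivN mulrN opprK addrC.
- by move=> x; exact: is_derive_poly_psi.
- move=> x ax xb; rewrite normrM (ger0_norm (ltW (psi_gt0 x))) -[leRHS]mulr1.
  apply: ler_pM => //; first exact: ltW (psi_gt0 x).
    by apply: le_trans (ler_norm M); apply: qM; rewrite ax xb.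
  by rewrite /psi -expR0 ler_expR oppr_le0 divr_ge0 // sqr_ge0.
Qed.

(** The integral of psi over [x, +oo[. *)
Definition gtail (R : realType) (x : R) : R := (1 - Phi x) / normal_peak 1.

Lemma peak_gt0 (R : realType) : 0 < normal_peak 1 :> R.
Proof. by apply: normal_peak_gt0; exact: oner_neq0. Qed.

Lemma gtailE (R : realType) (x : R) : 1 - Phi x = normal_peak 1 * gtail x.
Proof. by rewrite /gtail mulrC divfK // gt_eqF // peak_gt0. Qed.

Lemma gtail_increment (R : realType) (x y : R) : 0 <= x -> x <= y ->
  (y - x) * psi y <= gtail x - gtail y /\ gtail x - gtail y <= (y - x) * psi x.
Proof.
move=> x0 xy; have [h1 h2] := Phi_increment x0 xy.
move: h1 h2 (peak_gt0 R); rewrite /gtail; move: (normal_peak 1) => k h1 h2 k0.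
have -> : (1 - Phi x) / k - (1 - Phi y) / k = (Phi y - Phi x) / k.
  by rewrite -mulrBl; congr (_ / _); ring.
by rewrite ler_pdivlMr // ler_pdivrMr //; split; rewrite -mulrA [psi _ * _]mulrC.
Qed.

Lemma gtail_ge0 (R : realType) (x : R) : 0 <= gtail x.
Proof. by rewrite divr_ge0 ?subr_ge0 ?Phi_le1 // ltW // peak_gt0. Qed.

Lemma gtail0 (R : realType) : gtail (0 : R) = (2 * normal_peak 1)^-1.
Proof. by rewrite /gtail Phi0; have := peak_gt0 R; move=> h; field; rewrite gt_eqF. Qed.

(** On the interval from x to x + (1 + x)^-1 the density psi stays above
expR (- 3 / 2) * psi x. *)
Lemma gtail_ge (R : realType) (x : R) : 0 <= x ->
  psi x <= expR (3 / 2) * ((1 + x) * gtail x).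
Proof.
move=> x0; have x1 : 0 < 1 + x by rewrite ltr_pwDl.
pose h := (1 + x)^-1.
have h0 : 0 < h by rewrite invr_gt0.
have h1 : h <= 1 by rewrite invf_le1 // lerDl.
have hx : h * (1 + x) = 1 by rewrite mulVf // gt_eqF.
have xh : x <= x + h by rewrite lerDl ltW.
have [+ _] := gtail_increment x0 xh; rewrite addrAC subrr add0r => H.
have Hg : h * psi (x + h) <= gtail x by have := gtail_ge0 (x + h); lra.
have : psi x <= expR (3 / 2) * psi (x + h).
  rewrite /psi -expRD ler_expR; nra.
move=> /le_trans; apply; rewrite ler_pM2l ?expR_gt0 //.
have -> : psi (x + h) = (1 + x) * (h * psi (x + h)) by rewrite mulrA [_ * h]mulrC hx mul1r.
by rewrite ler_pM2l.
Qed.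

Lemma gtail_gt0 (R : realType) (x : R) : 0 <= x -> 0 < gtail x.
Proof.
move=> x0; have := lt_le_trans (psi_gt0 x) (gtail_ge x0).
rewrite pmulr_rgt0 ?expR_gt0 // pmulr_rgt0 //.
by rewrite ltr_pwDl.
Qed.

(** Beyond 1, psi u is at most u * psi u, whose primitive is - psi. *)
Lemma gtail_le (R : realType) (x : R) : 1 <= x -> gtail x <= psi x.
Proof.
move=> x1; have x0 : 0 <= x by rewrite (le_trans ler01).
apply/ler_addgt0Pr => e e0.
have [n hn] := @Phi_tail R (e * normal_peak 1) (mulr_gt0 e0 (peak_gt0 R)).
pose y := Num.max x n%:R.
have xy : x <= y by rewrite le_max lexx.
have ye : gtail y <= e.
  have n0 : 0 <= n%:R :> R by [].
  have ny : n%:R <= y by rewrite le_max lexx orbT.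
  have [h _] := gtail_increment n0 ny.
  have : 0 <= (y - n%:R) * psi y by rewrite mulr_ge0 ?subr_ge0 // ltW // psi_gt0.
  have : gtail n%:R <= e by rewrite /gtail ler_pdivrMr ?peak_gt0.
  lra.
have H : - gtail y - - gtail x <= (1 : {poly R}).[x] * psi x - (1 : {poly R}).[y] * psi y.
  apply: (@integrate_poly_psi _ (fun u => - gtail u) 1 x y 0) => // s t xs st ty.
  have [_ h] := gtail_increment (le_trans x0 xs) st.
  rewrite poly.derivE mulr1 subr0 hornerX.
  have : (t - s) * psi s <= (t - s) * (s * psi s).
    rewrite ler_wpM2l ?subr_ge0 // -[leLHS]mul1r ler_pM2r ?psi_gt0 //.
    exact: le_trans xs.
  lra.
move: H; rewrite !hornerE; have := psi_gt0 y; lra.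
Qed.

(** * The zero bias distribution *)

Definition mean (R : realType) (Omega : finType) (h : Omega -> R) : R :=
  (\sum_w h w) / #|Omega|%:R.

Lemma mean_le (R : realType) (Omega : finType) (f g : Omega -> R) :
  (forall w, f w <= g w) -> mean f <= mean g.
Proof. by move=> fg; rewrite ler_wpM2r ?invr_ge0 // ler_sum. Qed.

Lemma eq_mean (R : realType) (Omega : finType) (f g : Omega -> R) :
  f =1 g -> mean f = mean g.
Proof. by move=> fg; congr (_ / _); apply: eq_bigr. Qed.

Lemma meanD (R : realType) (Omega : finType) (f g : Omega -> R) :
  mean (fun w => f w + g w) = mean f + mean g.
Proof. by rewrite /mean big_split mulrDl. Qed.

Lemma meanN (R : realType) (Omega : finType) (f : Omega -> R) :
  mean (fun w => - f w) = - mean f.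
Proof. by rewrite /mean sumrN mulNr. Qed.

Lemma meanB (R : realType) (Omega : finType) (f g : Omega -> R) :
  mean (fun w => f w - g w) = mean f - mean g.
Proof. by rewrite meanD meanN. Qed.

Lemma meanZ (R : realType) (Omega : finType) (c : R) (f : Omega -> R) :
  mean (fun w => c * f w) = c * mean f.
Proof. by rewrite /mean -mulr_sumr mulrA. Qed.

Lemma mean1 (R : realType) (Omega : finType) : (0 < #|Omega|)%N ->
  mean (fun _ : Omega => 1 : R) = 1.
Proof.
move=> h; rewrite /mean sumr_const -mulr_natl mulr1 divff //.
by rewrite pnatr_eq0 -lt0n.
Qed.

Lemma mean0 (R : realType) (Omega : finType) :
  mean (fun _ : Omega => 0 : R) = 0.
Proof. by rewrite /mean big1 ?mul0r. Qed.

Lemma mean_ge0 (R : realType) (Omega : finType) (f : Omega -> R) :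
  (forall w, 0 <= f w) -> 0 <= mean f.
Proof. by move=> f0; rewrite -(mean0 R Omega) mean_le. Qed.

(** For g = F' the left-hand side is the mean of g under the zero bias distribution
of W; the inequality says that this distribution is stochastically below the law
of W + d.  The same property of - W bounds it from below. *)
Definition zero_bias_le (R : realType) (Omega : finType) (W : Omega -> R) (d : R) :=
  forall g F : R -> R, primitive_of g F ->
    mean (fun w => W w * F (W w)) <= mean (fun w => g (W w + d)).

Lemma zero_bias_ge (R : realType) (Omega : finType) (W : Omega -> R) (d : R) :
  zero_bias_le (fun w => - W w) d ->
  forall g F : R -> R, primitive_of g F ->
    mean (fun w => g (W w - d)) <= mean (fun w => W w * F (W w)).
Proof.
move=> zW g F gF.
(* reflecting F turns the inequality for - W into the opposite one for W *)
have gF' : primitive_of (fun x => - g (- x)) (fun x => F (- x)).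
  by move=> x y xy; have := gF (- y) (- x); rewrite lerN2 => /(_ xy) []; lra.
rewrite -lerN2 -!meanN.
have -> : mean (fun w => - (W w * F (W w))) = mean (fun w => - W w * F (- - W w)).
  by apply: eq_mean => w; rewrite opprK mulNr.
have -> : mean (fun w => - g (W w - d)) = mean (fun w => - g (- (- W w + d))).
  by apply: eq_mean => w; rewrite opprD opprK.
exact: zW gF'.
Qed.

(** The density at x of the zero bias distribution of W, when W has mean 0 and
variance 1. *)
Definition tail_mean (R : realType) (Omega : finType) (W : Omega -> R) (x : R) :=
  mean (fun w => W w * (x <= W w)%R%:R).

(** The tail of the zero bias distribution of W. *)
Definition star_tail (R : realType) (Omega : finType) (W : Omega -> R) (x : R) :=
  mean (fun w => W w * Num.max (W w - x) 0).

Definition upper_tail (R : realType) (Omega : finType) (W : Omega -> R) (x : R) :=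
  mean (fun w => (x <= W w)%R%:R : R).

(** The integral of u over [x, t]. *)
Definition half_square (R : realType) (x t : R) : R :=
  if x <= t then (t ^+ 2 - x ^+ 2) / 2 else 0.

(** The integral of u * tail_mean W (u + d) over u >= x. *)
Definition shifted_mean (R : realType) (Omega : finType) (W : Omega -> R) (d x : R) :=
  mean (fun w => W w * half_square x (W w - d)).

Lemma primitive_pos_part (R : realType) (x : R) :
  primitive_of (fun t => (x <= t)%R%:R) (fun t => Num.max (t - x) 0).
Proof.
move=> s t st; rewrite !maxEle !subr_le0.
case: (leP s x); case: (leP t x); case: (leP x s); case: (leP x t) => /=; split; nra.
Qed.

Lemma half_square_ge0 (R : realType) (x t : R) : 0 <= x -> 0 <= half_square x t.
Proof. by rewrite /half_square; case: (leP x t) => //= h x0; nra. Qed.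

Lemma primitive_half_square (R : realType) (x d : R) : 0 <= x ->
  primitive_of (fun t => (t + d) * (x <= t + d)%R%:R) (fun t => half_square x (t + d)).
Proof.
move=> x0 s t st; rewrite /half_square.
case: (leP x (s + d)); case: (leP x (t + d)) => /=; split; nra.
Qed.

(** What the analysis uses about W: m and H are the density and the tail of its zero
bias distribution, L is shifted_mean and G is the tail of W itself. *)
Record tail_profile (R : realType) (d : R) (m H L G : R -> R) : Prop := {
  profile_m_ge0 : forall x, 0 <= x -> 0 <= m x;
  profile_m_anti : forall x y, 0 <= x -> x <= y -> m y <= m x;
  profile_H_ge0 : forall x, 0 <= x -> 0 <= H x;
  profile_H_incr : forall x y, 0 <= x -> x <= y ->
    (y - x) * m y <= H x - H y /\ H x - H y <= (y - x) * m x;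
  profile_L_ge0 : forall x, 0 <= x -> 0 <= L x;
  profile_L_le : forall x, 0 <= x -> L x <= m x;
  profile_L_ge : forall x v, 0 <= x -> v = Num.max (x - d) 0 ->
    m x <= L x + 2 * d * (H v + (v + d) * m v);
  profile_L_incr : forall x y, 0 <= x -> x <= y ->
    (y ^+ 2 - x ^+ 2) / 2 * m (y + d) <= L x - L y /\
    L x - L y <= (y ^+ 2 - x ^+ 2) / 2 * m (x + d);
  profile_mills : forall x, 0 <= x -> x * H (x + d) <= m x;
  profile_G_ge : forall x, 0 <= x -> H (x + d) <= G x;
  profile_G_le : forall x v, 0 <= x -> v = Num.max (x - d) 0 ->
    G x <= H v + d * m v;
  profile_m0_le : m 0 <= 1;
  profile_m0_ge : 12^-1 <= m 0;
  profile_H0_le : H 0 <= 1 }.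

Lemma mean_sqr1 (R : realType) (Omega : finType) (W : Omega -> R) (d : R) :
  (0 < #|Omega|)%N -> zero_bias_le W d -> zero_bias_le (fun w => - W w) d ->
  mean (fun w => W w * W w) = 1.
Proof.
move=> c0 zW zWN; have p1 : primitive_of (fun=> 1 : R) id.
  by move=> x y _; rewrite mulr1.
apply/eqP; rewrite eq_le; have := zW _ _ p1; rewrite (mean1 R c0) => -> /=.
by have := zero_bias_ge zWN p1; rewrite (mean1 R c0).
Qed.

(** The coupling of W with its zero bias version at distance d, applied to the
indicator of a half-line. *)
Lemma upper_tail_bounds (R : realType) (Omega : finType) (W : Omega -> R) (d x : R) :
  zero_bias_le W d -> zero_bias_le (fun w => - W w) d ->
  upper_tail W (x + d) <= star_tail W x /\ star_tail W x <= upper_tail W (x - d).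
Proof.
move=> zW zWN; split.
  apply: le_trans (zero_bias_ge zWN (primitive_pos_part x)).
  by apply: mean_le => w; rewrite lerBrDr.
apply: le_trans (zW _ _ (primitive_pos_part x)) _.
by apply: mean_le => w; rewrite lerBlDr.
Qed.

Lemma mean_eq0 (R : realType) (Omega : finType) (W : Omega -> R) (d : R) :
  zero_bias_le W d -> zero_bias_le (fun w => - W w) d -> mean W = 0.
Proof.
move=> zW zWN; have p0 : primitive_of (fun=> 0 : R) (fun=> 1).
  by move=> x y _; rewrite mulr0 subrr.
have -> : mean W = mean (fun w => W w * 1) by apply: eq_mean => w; rewrite mulr1.
apply/eqP; rewrite eq_le; have := zW _ _ p0; rewrite (mean0 R Omega) => -> /=.
by have := zero_bias_ge zWN p0; rewrite (mean0 R Omega).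
Qed.

Lemma tail_mean_opp0 (R : realType) (Omega : finType) (W : Omega -> R) :
  mean W = 0 -> tail_mean (fun w => - W w) 0 = tail_mean W 0.
Proof.
move=> W0; apply/eqP; rewrite eq_sym -subr_eq0; apply/eqP.
rewrite -[RHS]W0 -meanB; apply: eq_mean => w.
by case: (leP 0 (W w)); case: (leP 0 (- W w)) => /= h1 h2; lra.
Qed.

Lemma star_tail_opp0 (R : realType) (Omega : finType) (W : Omega -> R) :
  star_tail W 0 + star_tail (fun w => - W w) 0 = mean (fun w => W w * W w).
Proof.
rewrite -meanD; apply: eq_mean => w; rewrite !subr0 !maxEle.
by case: (leP (W w) 0); case: (leP (- W w) 0) => /= h1 h2; nra.
Qed.

Lemma tail_mean_ge0 (R : realType) (Omega : finType) (W : Omega -> R) x :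
  0 <= x -> 0 <= tail_mean W x.
Proof.
by move=> x0; apply: mean_ge0 => w; case: (leP x (W w)) => /= h; nra.
Qed.

Lemma tail_mean_anti (R : realType) (Omega : finType) (W : Omega -> R) x y :
  0 <= x -> x <= y -> tail_mean W y <= tail_mean W x.
Proof.
move=> x0 xy; apply: mean_le => w.
by case: (leP x (W w)); case: (leP y (W w)) => /= h1 h2; nra.
Qed.

Lemma star_tail_ge0 (R : realType) (Omega : finType) (W : Omega -> R) x :
  0 <= x -> 0 <= star_tail W x.
Proof.
move=> x0; apply: mean_ge0 => w; rewrite maxEle subr_le0.
by case: (leP (W w) x) => /= h; nra.
Qed.

Lemma star_tail_incr (R : realType) (Omega : finType) (W : Omega -> R) x y :
  0 <= x -> x <= y ->
  (y - x) * tail_mean W y <= star_tail W x - star_tail W y /\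
  star_tail W x - star_tail W y <= (y - x) * tail_mean W x.
Proof.
move=> x0 xy; rewrite -!meanB -!meanZ.
suff h w : (y - x) * (W w * (y <= W w)%R%:R) <=
      W w * Num.max (W w - x) 0 - W w * Num.max (W w - y) 0 /\
    W w * Num.max (W w - x) 0 - W w * Num.max (W w - y) 0 <=
      (y - x) * (W w * (x <= W w)%R%:R).
  by split; apply: mean_le => w; have [] := h w.
move: (W w) => t; have [tn|tp] := leP t 0.
  rewrite !maxEle !subr_le0.
  by case: (leP t x); case: (leP t y); case: (leP y t); case: (leP x t)
    => /= h1 h2 h3 h4; split; nra.
rewrite ![(y - x) * _]mulrCA -mulrBr !ler_pM2l //.
have [yt|/ltW ty] := leP y t.
  by rewrite (le_trans xy yt) !max_l ?subr_ge0 ?(le_trans xy yt) //=; split; lra.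
rewrite (max_r (_ : t - y <= 0)) ?subr_le0 //.
have [xt|/ltW tx] := leP x t; first by rewrite max_l ?subr_ge0 //=; split; lra.
by rewrite max_r ?subr_le0 //=; split; lra.
Qed.

Lemma shifted_mean_ge0 (R : realType) (Omega : finType) (W : Omega -> R) d x :
  0 <= d -> 0 <= x -> 0 <= shifted_mean W d x.
Proof.
move=> d0 x0; apply: mean_ge0 => w.
have [Wp|Wn] := leP 0 (W w); first by rewrite mulr_ge0 ?half_square_ge0.
rewrite /half_square (_ : (x <= W w - d) = false) ?mulr0 //.
by apply/negbTE; rewrite -ltNge; lra.
Qed.

(** For x >= 0 the function t |-> t [t >= x] is nondecreasing with primitive
half_square x; for Z with the zero bias distribution, its value
at Z - d is at most its value at W. *)
Lemma shifted_mean_le (R : realType) (Omega : finType) (W : Omega -> R) d x :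
  zero_bias_le W d -> 0 <= x -> shifted_mean W d x <= tail_mean W x.
Proof.
move=> zW x0; apply: le_trans (zW _ _ (primitive_half_square (- d) x0)) _.
by apply: mean_le => w; rewrite addrK.
Qed.

(** The coupling bounds tail_mean W x by the mean of W * half_square x (W + d).  This
differs from shifted_mean by at most the mean of 2 d W (W + d) over W >= v, and
W ^+ 2 = W (W - v) + v W. *)
Lemma shifted_mean_ge (R : realType) (Omega : finType) (W : Omega -> R) d x v :
  zero_bias_le (fun w => - W w) d -> 0 < d -> 0 <= x ->
  v = Num.max (x - d) 0 ->
  tail_mean W x <= shifted_mean W d x +
    2 * d * (star_tail W v + (v + d) * tail_mean W v).
Proof.
move=> zWN d_gt0 x0 vE; have d0 := ltW d_gt0.
have := zero_bias_ge zWN (primitive_half_square d x0).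
have -> : mean (fun w => (W w - d + d) * (x <= W w - d + d)%R%:R) = tail_mean W x.
  by apply: eq_mean => w; rewrite subrK.
move=> /le_trans; apply.
rewrite -lerBlDl -meanB -meanZ -meanD -meanZ; apply: mean_le => w.
have [xv v0] : x - d <= v /\ 0 <= v by rewrite vE !le_max !lexx orbT.
have xv' : v = x - d \/ v = 0.
  by rewrite vE maxEle; case: ifP; [right|left].
have [Wn|Wp] := leP (W w) 0.
  rewrite [half_square x (W w - d)]/half_square maxEle subr_le0.
  have -> : (x <= W w - d) = false by apply/negbTE; rewrite -ltNge; lra.
  have r0 : W w * (v <= W w)%R%:R = 0 by case: (leP v (W w)) => /= h; lra.
  have l0 : W w * half_square x (W w + d) <= 0.
    by rewrite mulr_le0_ge0 // half_square_ge0.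
  move: l0; rewrite (le_trans Wn v0) r0; lra.
move: (W w) Wp => t tp.
have key : half_square x (t + d) - half_square x (t - d) <=
    2 * d * (Num.max (t - v) 0 + (v + d) * (v <= t)%R%:R).
  rewrite /half_square; case: (leP x (t + d)) => h.
    have vt : v <= t by case: xv' => ->; lra.
    rewrite vt mulr1 max_l ?subr_ge0 //.
    case: (leP x (t - d)) => h'; first by have := sqr_ge0 d; lra.
    have [dt|td] := leP d t.
      have : (t - d) ^+ 2 <= x ^+ 2 by rewrite lerXn2r ?nnegrE ?subr_ge0 // ltW.
      have := sqr_ge0 d; lra.
    have : (t + d) * (t + d) <= (t + d) * (2 * d) by rewrite ler_wpM2l; lra.
    have : 0 <= d * (t + d) by rewrite mulr_ge0 // addr_ge0 // ltW.
    have := sqr_ge0 x; lra.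
  have -> : (x <= t - d) = false by apply/negbTE; rewrite -ltNge; lra.
  rewrite subrr mulr_ge0 ?mulr_ge0 // addr_ge0 ?mulr_ge0 ?addr_ge0 //.
  by rewrite le_max lexx orbT.
move: key => /(ler_wpM2l (ltW tp)) key.
by rewrite -mulrBr; apply: le_trans key _; rewrite le_eqVlt; apply/orP; left; apply/eqP; ring.
Qed.

Lemma half_square_incr (R : realType) (x y t : R) : 0 <= x -> x <= y ->
  (y ^+ 2 - x ^+ 2) / 2 * (y <= t)%R%:R <= half_square x t - half_square y t /\
  half_square x t - half_square y t <= (y ^+ 2 - x ^+ 2) / 2 * (x <= t)%R%:R.
Proof.
move=> x0 xy; have sq : x ^+ 2 <= y ^+ 2.
  by rewrite lerXn2r // nnegrE (le_trans x0).
rewrite /half_square; case: (leP y t) => yt.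
  by rewrite (le_trans xy yt) /=; split; lra.
case: (leP x t) => xt /=; last by split; lra.
have : t ^+ 2 <= y ^+ 2 by rewrite lerXn2r ?nnegrE ?(ltW yt) // (le_trans x0).
have : x ^+ 2 <= t ^+ 2 by rewrite lerXn2r ?nnegrE // (le_trans x0).
by split; lra.
Qed.

Lemma shifted_mean_incr (R : realType) (Omega : finType) (W : Omega -> R) d x y :
  0 < d -> 0 <= x -> x <= y ->
  (y ^+ 2 - x ^+ 2) / 2 * tail_mean W (y + d) <= shifted_mean W d x - shifted_mean W d y /\
  shifted_mean W d x - shifted_mean W d y <= (y ^+ 2 - x ^+ 2) / 2 * tail_mean W (x + d).
Proof.
move=> d0 x0 xy; rewrite -!meanB -!meanZ.
suff h w : (y ^+ 2 - x ^+ 2) / 2 * (W w * (y + d <= W w)%R%:R) <=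
      W w * half_square x (W w - d) - W w * half_square y (W w - d) /\
    W w * half_square x (W w - d) - W w * half_square y (W w - d) <=
      (y ^+ 2 - x ^+ 2) / 2 * (W w * (x + d <= W w)%R%:R).
  by split; apply: mean_le => w; have [] := h w.
move: (W w) => t; rewrite -(lerBrDr y t d) -(lerBrDr x t d).
have [h1 h2] := half_square_incr (t - d) x0 xy.
have [tn|tp] := leP t 0; last first.
  by rewrite -mulrBr ![_ / 2 * (t * _)]mulrCA !ler_pM2l.
have f z : 0 <= z -> (z <= t - d) = false by move=> z0; apply/negbTE; rewrite -ltNge; lra.
by rewrite /half_square !f ?(le_trans x0) //= !mulr0 subr0.
Qed.

(** On W >= x the factor W is at least x, and P(W >= x) is at least
star_tail W (x + d). *)
Lemma tail_mean_mills (R : realType) (Omega : finType) (W : Omega -> R) d x :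
  zero_bias_le W d -> zero_bias_le (fun w => - W w) d -> 0 <= x ->
  x * star_tail W (x + d) <= tail_mean W x.
Proof.
move=> zW zWN x0; have [_] := upper_tail_bounds (x + d) zW zWN.
rewrite addrK => /(ler_wpM2l x0) /le_trans; apply.
rewrite -meanZ; apply: mean_le => w.
by case: (leP x (W w)) => /= h; rewrite ?mulr1 ?mulr0.
Qed.

Lemma star_tail0_le1 (R : realType) (Omega : finType) (W : Omega -> R) :
  mean (fun w => W w * W w) = 1 -> star_tail W 0 <= 1.
Proof.
move=> <-; apply: mean_le => w; rewrite subr0 maxEle.
by case: (leP (W w) 0) => /= h; nra.
Qed.

Lemma tail_mean0_le1 (R : realType) (Omega : finType) (W : Omega -> R) :
  (0 < #|Omega|)%N -> mean (fun w => W w * W w) = 1 -> tail_mean W 0 <= 1.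
Proof.
move=> c0 W2; have : tail_mean W 0 <= mean (fun w => 2^-1 * (W w * W w + 1)).
  apply: mean_le => w; have := sqr_ge0 (W w - 1); have := sqr_ge0 (W w).
  by case: (leP 0 (W w)) => /= h; lra.
by rewrite meanZ meanD W2 (mean1 R c0); lra.
Qed.

Lemma upper_tail2_le (R : realType) (Omega : finType) (W : Omega -> R) :
  mean (fun w => W w * W w) = 1 -> upper_tail W 2 <= 4^-1.
Proof.
move=> W2; have : upper_tail W 2 <= mean (fun w => 4^-1 * (W w * W w)).
  by apply: mean_le => w; case: (leP 2 (W w)) => /= h; nra.
by rewrite meanZ W2 mulr1.
Qed.

(** The density of the zero bias distribution is largest at 0 and its tail beyond 3
is at most P(W >= 2), so its value at 0 cannot be small. *)
Lemma star_tail0_upper (R : realType) (Omega : finType) (W : Omega -> R) d :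
  zero_bias_le W d -> zero_bias_le (fun w => - W w) d -> d <= 1 ->
  mean (fun w => W w * W w) = 1 -> star_tail W 0 <= 3 * tail_mean W 0 + 4^-1.
Proof.
move=> zW zWN d1 W2; have h03 : (0 : R) <= 3 by [].
have [_] := star_tail_incr W (lexx 0) h03; rewrite subr0.
have [_ h] := upper_tail_bounds 3 zW zWN.
have : upper_tail W (3 - d) <= upper_tail W 2.
  apply: mean_le => w; case: (leP (3 - d) (W w)) => /= h1 //.
  by rewrite (_ : 2 <= W w) //; lra.
by have := upper_tail2_le W2; lra.
Qed.

Lemma zero_bias_profile (R : realType) (Omega : finType) (W : Omega -> R) (d : R) :
  (0 < #|Omega|)%N -> 0 < d -> d <= 1 ->
  zero_bias_le W d -> zero_bias_le (fun w => - W w) d ->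
  tail_profile d (tail_mean W) (star_tail W) (shifted_mean W d) (upper_tail W).
Proof.
move=> c0 d0 d1 zW zWN; have W2 := mean_sqr1 c0 zW zWN.
have zWNN : zero_bias_le (fun w => - - W w) d.
  by move=> g F gF; have := zW g F gF; congr (_ <= _); apply: eq_mean => w; rewrite opprK.
split.
- exact: tail_mean_ge0.
- exact: tail_mean_anti.
- exact: star_tail_ge0.
- exact: star_tail_incr.
- by move=> x; apply: shifted_mean_ge0; exact: ltW.
- by move=> x; exact: shifted_mean_le.
- by move=> x v x0; exact: shifted_mean_ge.
- by move=> x y; exact: shifted_mean_incr.
- by move=> x; exact: tail_mean_mills.
- by move=> x _; have [_] := upper_tail_bounds (x + d) zW zWN; rewrite addrK.
- move=> x v x0 vE; have [+ _] := upper_tail_bounds (x - d) zW zWN.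
  rewrite subrK => /le_trans; apply.
  have [dx|xd] := leP d x.
    have -> : v = x - d by rewrite vE max_l // subr_ge0.
    by rewrite lerDl mulr_ge0 ?(ltW d0) // tail_mean_ge0 // subr_ge0.
  have -> : v = 0 by rewrite vE max_r // subr_le0 ltW.
  rewrite -meanZ -meanD; apply: mean_le => w; rewrite subr0 !maxEle.
  by case: (leP (W w - (x - d)) 0); case: (leP (W w) 0); case: (leP 0 (W w)) => /= *; nra.
- exact: tail_mean0_le1.
- have := star_tail0_upper zW zWN d1 W2.
  have W2N : mean (fun w => - W w * - W w) = 1.
    by rewrite -W2; apply: eq_mean => w; rewrite mulrNN.
  have := star_tail0_upper zWN zWNN d1 W2N.
  rewrite tail_mean_opp0 ?(mean_eq0 zW zWN) //.
  by have := star_tail_opp0 W; rewrite W2; lra.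
- exact: star_tail0_le1.
Qed.

(** * The density of the zero bias distribution *)

(** One step of the differential inequality for L from 0 to 1 loses at most half of
m 0, up to O(d). *)
Lemma profile_m1 (R : realType) (d : R) (m H L G : R -> R) :
  tail_profile d m H L G -> 0 < d -> d <= 384^-1 -> 32^-1 <= m 1.
Proof.
move=> P d0 d1.
have := profile_L_ge P (lexx 0) (esym (max_r _)).
rewrite sub0r oppr_le0 => /(_ (ltW d0)); rewrite add0r => h1.
have [_] := profile_L_incr P (lexx 0) ler01.
have := profile_m_anti P (lexx 0) (ltW d0).
have := profile_L_le P ler01; have := profile_m0_ge P; have := profile_H0_le P.
have := profile_m0_le P; rewrite add0r => h2 h3 h4 h5 h6 h7.
have : d * m 0 <= d by rewrite -[leRHS]mulr1 ler_pM2l.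
have : d * H 0 <= d by rewrite -[leRHS]mulr1 ler_pM2l.
have : d * (d * m 0) <= d.
  by rewrite -[leRHS]mulr1 ler_pM2l //; have := profile_m_ge0 P (lexx 0); nra.
lra.
Qed.

(** The density m drops by at most a constant factor over a distance d.  The bounds of
m by L at x - d involve m (x - 2 d), which the induction hypothesis controls
at x - d; the resulting term is absorbed because d (x + 2) is small. *)
Lemma profile_ratio (R : realType) (d : R) (m H L G : R -> R) (x : R) :
  tail_profile d m H L G -> 0 < d -> d <= 384^-1 ->
  0 <= x -> d * (x + 2) <= 128^-1 ->
  m (Num.max (x - d) 0) <= 32 * m x.
Proof.
move=> P d0 d1.
have small y : 0 <= y -> y <= 1 -> m (Num.max (y - d) 0) <= 32 * m y.
  move=> y0 y1; apply: (@le_trans _ _ (m 0)).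
    by apply: (profile_m_anti P) => //; rewrite le_max lexx orbT.
  have := profile_m0_le P; have := profile_m1 P d0 d1.
  by have := profile_m_anti P y0 y1; lra.
suff step k y : 0 <= y -> y <= 1 + k%:R * d -> d * (y + 2) <= 128^-1 ->
    m (Num.max (y - d) 0) <= 32 * m y.
  move=> x0; apply: (step (Num.truncn (x / d)).+1) => //.
  have : x / d < (Num.truncn (x / d)).+1%:R by apply: truncnS_gt.
  rewrite ltr_pdivrMr // => /ltW; lra.
elim: k y => [|k IH] y y0; first by rewrite mul0r addr0 => /small - /(_ y0).
rewrite -natr1 => yk dy; have [/small|y1] := leP y 1; first exact.
have u0 : 0 <= y - d by lra.
have v0 : 0 <= y - 2 * d by lra.
have vE : Num.max (y - d - d) 0 = y - 2 * d.
  by rewrite max_l; [ring|lra].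
rewrite max_l //.
have dyd : d * (y - d + 2) <= 128^-1.
  by apply: le_trans dy; rewrite ler_pM2l //; lra.
have := IH (y - d) u0 ltac:(lra) dyd; rewrite vE.
have := profile_L_ge P u0 (esym vE).
have uy : y - d <= y by lra.
have [_] := profile_L_incr P u0 uy; rewrite subrK.
have := profile_L_le P y0.
have vy : y - 2 * d <= y + d by lra.
have [_] := profile_H_incr P v0 vy.
have := profile_mills P y0.
have yd0 : 0 <= y + d by lra.
have := profile_H_ge0 P yd0.
have := profile_m_ge0 P y0; have := profile_m_ge0 P u0; have := profile_m_ge0 P v0.
set a := m (y - d); set b := m y; set c := m (y - 2 * d).
set Hv := H (y - 2 * d); set Hd := H (y + d) => c0 a0 b0 Hd0 h1 h2 h3 h4 h5 h6.
have Hb : Hd <= b by nra.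
have e1 : d * Hv <= d * (b + 3 * d * c) by rewrite ler_pM2l //; lra.
have e2 : d * (y + 2 * d) * c <= d * (y + 2 * d) * (32 * a).
  by rewrite ler_wpM2l // mulr_ge0 //; lra.
have e3 : d * (y + 2 * d) * a <= 128^-1 * a.
  by rewrite ler_wpM2r //; apply: le_trans dy; rewrite ler_pM2l //; lra.
have e4 : d * (y + 2) * b <= 128^-1 * b by rewrite ler_wpM2r.
have e5 : 0 <= d * d * b by rewrite !mulr_ge0 // ltW.
lra.
Qed.

(** The error between m and L is O(d) (H + x m) just before x; there m is comparable
with m x by profile_ratio, and H is at most O(m x) by the Mills bound for
x >= 1 and by profile_m1 below 1. *)
Lemma profile_defect (R : realType) (d : R) (m H L G : R -> R) (x : R) :
  tail_profile d m H L G -> 0 < d -> d <= 384^-1 ->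
  0 <= x -> d * (x + 2) <= 128^-1 ->
  m x <= L x + 128 * d * (1 + x) * m x /\ H x <= 32 * m x.
Proof.
move=> P d0 d1 x0 dx; set v := Num.max (x - d) 0.
have v0 : 0 <= v by rewrite le_max lexx orbT.
have vx : v <= x by rewrite ge_max x0 andbT; lra.
have mv := profile_ratio P d0 d1 x0 dx; rewrite -/v in mv.
have mx0 := profile_m_ge0 P x0; have mv0 := profile_m_ge0 P v0.
have Hv : H v <= 32 * m x.
  have [x1|x1] := leP x 1.
    have z0 := lexx (0 : R).
    have [h1 _] := profile_H_incr P z0 v0.
    have h2 := profile_H0_le P; have h3 := profile_m1 P d0 d1.
    have h4 := profile_m_anti P x0 x1.
    have : 0 <= (v - 0) * m v by rewrite subr0 mulr_ge0.
    lra.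
  have vE : v = x - d by rewrite /v max_l //; lra.
  have xd0 : 0 <= x + d by lra.
  have vxd : v <= x + d by lra.
  have [_ h1] := profile_H_incr P v0 vxd.
  have h2 := profile_mills P x0; have h3 := profile_H_ge0 P xd0.
  have : H (x + d) <= m x by nra.
  have : (x + d - v) * m v <= 2 * 384^-1 * (32 * m x).
    by apply: ler_pM => //; rewrite vE; lra.
  lra.
split; last first.
  have [h1 _] := profile_H_incr P v0 vx.
  have : 0 <= (x - v) * m x by rewrite mulr_ge0 // subr_ge0.
  lra.
apply: le_trans (profile_L_ge P x0 (erefl v)) _; rewrite lerD2l.
have h : (v + d) * m v <= (x + 1) * (32 * m x) by apply: ler_pM => //; lra.
have -> : 128 * d * (1 + x) * m x = 2 * d * (64 * ((1 + x) * m x)) by ring.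
rewrite ler_pM2l ?mulr_gt0 //.
have : 0 <= x * m x by rewrite mulr_ge0.
lra.
Qed.

Lemma profile_m_le_L (R : realType) (d eps : R) (m H L G : R -> R) (x w : R) :
  tail_profile d m H L G -> 0 < d -> d <= 384^-1 ->
  eps = 256 * d * (1 + x) -> eps <= 2^-1 -> 0 <= w -> w <= x ->
  m w <= (1 + eps) * L w.
Proof.
move=> P d0 d1 epsE eps1 w0 wx.
have dw : d * (1 + w) <= d * (1 + x) by rewrite ler_pM2l // lerD2l.
have dw1 : 0 <= d * (1 + w) by rewrite mulr_ge0 ?addr_ge0 // ltW.
have [|h _] := profile_defect P d0 d1 w0.
  have : d * (w + 2) <= d * (2 * (1 + w)) by rewrite ler_pM2l //; lra.
  lra.
have m0 := profile_m_ge0 P w0.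
have e0 : 0 <= eps by rewrite epsE; lra.
have : 128 * d * (1 + w) * m w <= eps / 2 * m w by rewrite ler_wpM2r //; lra.
move=> h2; have h3 : (1 - eps / 2) * m w <= L w by lra.
have e1 : 0 <= 1 + eps by lra.
have := ler_wpM2l e1 h3.
have : 0 <= eps * m w * (1 - eps) by rewrite !mulr_ge0 //; lra.
lra.
Qed.

(** In the variable x ^+ 2 / 2 the function L has slope - m (x + d), which lies
between - (1 + eps) L and - (1 - eps) L; Gronwall's inequality forwards and
backwards gives the two bounds. *)
Lemma profile_L_gaussian (R : realType) (d eps : R) (m H L G : R -> R) (x : R) :
  tail_profile d m H L G -> 0 < d -> d <= 384^-1 -> 0 <= x ->
  eps = 256 * d * (1 + x) -> eps <= 2^-1 ->
  L 0 * expR (- (1 + eps) * (x ^+ 2 / 2)) <= L x /\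
  L x * expR ((1 - eps) * (x ^+ 2 / 2)) <= L 0.
Proof.
move=> P d0 d1 x0 epsE eps1.
have mL w : 0 <= w -> w <= x -> m w <= (1 + eps) * L w.
  by move=> w0 wx; exact: (profile_m_le_L P d0 d1 epsE eps1).
have e0 : 0 <= eps by rewrite epsE; have := mulr_ge0 (ltW d0) x0; lra.
have up w w' : 0 <= w -> w <= w' -> w' <= x ->
    L w - L w' <= (w' ^+ 2 - w ^+ 2) / 2 * ((1 + eps) * L w).
  move=> w0 ww wx; have [_ h] := profile_L_incr P w0 ww; apply: le_trans h _.
  rewrite ler_wpM2l //; first by rewrite divr_ge0 // subr_ge0 lerXn2r ?nnegrE // (le_trans w0).
  apply: le_trans (mL _ w0 (le_trans ww wx)).
  by apply: (profile_m_anti P) => //; rewrite lerDl ltW.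
have lo w w' : 0 <= w -> w <= w' -> w' <= x ->
    (w' ^+ 2 - w ^+ 2) / 2 * ((1 - eps) * L w') <= L w - L w'.
  move=> w0 ww wx; have [h _] := profile_L_incr P w0 ww; apply: le_trans h.
  rewrite ler_wpM2l //; first by rewrite divr_ge0 // subr_ge0 lerXn2r ?nnegrE // (le_trans w0).
  have w'0 := le_trans w0 ww.
  have wd : w' <= w' + d by rewrite lerDl ltW.
  have wd0 := le_trans w'0 wd.
  have [_ h] := profile_L_incr P w'0 wd.
  have h1 := profile_L_le P wd0.
  have wdd : w' + d <= w' + d + d by rewrite lerDl ltW.
  have L0 := profile_L_ge0 P w'0.
  have h2 : m (w' + d) <= 2 * L w'.
    apply: (@le_trans _ _ (m w')); first exact: (profile_m_anti P).
    by apply: le_trans (mL _ w'0 wx) _; rewrite ler_wpM2r //; lra.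
  have h3 : ((w' + d) ^+ 2 - w' ^+ 2) / 2 * m (w' + d) <= (d * (1 + x)) * (2 * L w').
    have -> : ((w' + d) ^+ 2 - w' ^+ 2) / 2 = d * (w' + d / 2) by field.
    apply: ler_pM => //; first by rewrite mulr_ge0 ?addr_ge0 ?divr_ge0 // ltW.
      exact: (profile_m_ge0 P).
    by rewrite ler_pM2l //; lra.
  have h4 : d * (1 + x) * (2 * L w') <= eps * L w'.
    have : 0 <= d * (1 + x) by rewrite mulr_ge0 ?addr_ge0 // ltW.
    by move=> h40; rewrite mulrA ler_wpM2r // epsE; lra.
  have h5 : m (w' + d + d) <= m (w' + d) by apply: (profile_m_anti P).
  lra.
have T0 : 0 <= x ^+ 2 / 2 by rewrite divr_ge0 // sqr_ge0.
pose f s := L (Num.sqrt (2 * s)).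
have f0 : f 0 = L 0 by rewrite /f mulr0 sqrtr0.
have fT : f (x ^+ 2 / 2) = L x by rewrite /f mulrC divfK // sqrtr_sqr ger0_norm.
have sx s : s <= x ^+ 2 / 2 -> Num.sqrt (2 * s) <= x.
  move=> sT; rewrite -[leRHS](ger0_norm x0) -sqrtr_sqr ler_wsqrtr //; lra.
have sq s : 0 <= s -> Num.sqrt (2 * s) ^+ 2 = 2 * s.
  by move=> s0; rewrite sqr_sqrtr // mulr_ge0.
have fB s : 0 <= s -> s <= x ^+ 2 / 2 -> 0 <= f s /\ f s <= 1.
  move=> s0 sT; have r0 := sqrtr_ge0 (2 * s); split; first exact: (profile_L_ge0 P).
  apply: le_trans (profile_L_le P r0) _; apply: le_trans (profile_m0_le P).
  exact: (profile_m_anti P).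
split.
  rewrite -f0 -fT; apply: (@gronwall_lower _ f (1 + eps) _ 1) => // s t s0 st tT.
  have := up _ _ (sqrtr_ge0 (2 * s)) _ (sx _ tT).
  rewrite ler_wsqrtr ?ler_wpM2l // => /(_ isT).
  rewrite !sq ?(le_trans s0) // -/(f s) -/(f t); lra.
have -> : (1 - eps) * (x ^+ 2 / 2) = - (- (1 - eps)) * (x ^+ 2 / 2) by rewrite opprK.
pose g s := f (x ^+ 2 / 2 - s).
have <- : g 0 = L x by rewrite /g subr0.
have <- : g (x ^+ 2 / 2) = L 0 by rewrite /g subrr.
apply: (@gronwall_lower _ g (- (1 - eps)) _ 1) => //.
  by move=> s s0 sT; apply: fB; lra.
move=> s t s0 st tT; rewrite /g.
set s' := x ^+ 2 / 2 - s; set t' := x ^+ 2 / 2 - t.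
have t's' : t' <= s' by rewrite /t' /s'; lra.
have t'0 : 0 <= t' by rewrite /t'; lra.
have s'T : s' <= x ^+ 2 / 2 by rewrite /s'; lra.
have := lo _ _ (sqrtr_ge0 (2 * t')) _ (sx _ s'T).
rewrite ler_wsqrtr ?ler_wpM2l // => /(_ isT).
rewrite !sq ?(le_trans t'0) // -/(f s') -/(f t').
have -> : t - s = s' - t' by rewrite /s' /t'; ring.
lra.
Qed.

Lemma cube_bounds (R : realType) (x : R) : 0 <= x ->
  (1 + x) * x ^+ 2 <= 2 * (1 + x ^+ 3) /\ 1 + x <= 2 * (1 + x ^+ 3) /\
  (1 + x ^+ 2) * (1 + x) <= 4 * (1 + x ^+ 3).
Proof.
move=> x0; have x3 : x ^+ 3 = x ^+ 2 * x by rewrite exprSr.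
have [x1|/ltW x1] := leP x 1.
  have h2 : x ^+ 2 <= 1 by rewrite expr_le1.
  have h3 : 0 <= x ^+ 3 by rewrite exprn_ge0.
  lra.
have h1 : x <= x ^+ 2 by rewrite expr2 ler_peMl.
have h2 : x ^+ 2 <= x ^+ 3 by rewrite x3 ler_peMr // sqr_ge0.
lra.
Qed.

(** The exponent eps x ^+ 2 is O(d (1 + x ^+ 3)), which stays bounded in the range
considered, so its exponential is 1 + O(d (1 + x ^+ 3)). *)
Lemma profile_m_gaussian (R : realType) : exists2 K : R, 0 < K &
  forall (d : R) (m H L G : R -> R) (x : R),
  tail_profile d m H L G -> 0 < d -> d <= 384^-1 -> 0 <= x ->
  256 * d * (1 + x) <= 2^-1 -> d * x ^+ 3 <= 96 ->
  `|m x - m 0 * psi x| <= K * (d * (1 + x ^+ 3)) * psi x.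
Proof.
have [E EE E0] : exists2 E : R, E = expR (256 * 97) & 0 < E.
  by exists (expR (256 * 97)); [exact: erefl|exact: expR_gt0].
exists (512 + 384 * E); first lra.
move=> d m H L G x P d0 d1 x0 eps1 dx3.
set eps := 256 * d * (1 + x) in eps1; have epsE : eps = 256 * d * (1 + x) by exact: erefl.
clearbody eps.
have [c1 [c2 _]] := cube_bounds x0.
set tau := d * (1 + x ^+ 3); have tauE : tau = d * (1 + x ^+ 3) by exact: erefl.
clearbody tau.
have tau97 : tau <= 97 by rewrite tauE; lra.
have x30 : 0 <= x ^+ 3 by rewrite exprn_ge0.
have dtau : d <= tau by rewrite tauE ler_peMr ?(ltW d0) // lerDl.
have tau0 : 0 <= tau by lra.
have dx0 : 0 <= d * x by rewrite mulr_ge0 // ltW.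
have e0 : 0 <= eps by rewrite epsE; lra.
have epstau : eps <= 512 * tau.
  by have := ler_wpM2l (ltW d0) c2; rewrite epsE tauE; lra.
set y := eps * (x ^+ 2 / 2); have yE : y = eps * (x ^+ 2 / 2) by exact: erefl.
clearbody y.
have y0 : 0 <= y by rewrite yE mulr_ge0 // divr_ge0 // sqr_ge0.
have ytau : y <= 256 * tau.
  by have := ler_wpM2l (ltW d0) c1; rewrite yE epsE tauE; lra.
have eyE : expR y <= E by rewrite EE ler_expR; lra.
have ey : expR y <= 1 + 256 * tau * E.
  have h1 : 1 - y <= expR (- y) by have := expR_ge1Dx (- y).
  have h2 : expR (- y) * expR y = 1 by rewrite -expRD addNr expR0.
  have h3 := ler_wpM2r (ltW (expR_gt0 y)) h1.
  have h4 : y * expR y <= 256 * tau * E by apply: ler_pM => //; exact: expR_ge0.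
  lra.
have [lo up] := profile_L_gaussian P d0 d1 x0 epsE eps1.
have mL := profile_m_le_L P d0 d1 epsE eps1 x0 (lexx x).
have Lm := profile_L_le P x0.
have m00 := profile_m_ge0 P (lexx 0); have m01 := profile_m0_le P.
have L00 := profile_L_ge0 P (lexx 0); have L0m := profile_L_le P (lexx 0).
have p0 := psi_gt0 x.
have up' : L x <= m 0 * (psi x * expR y).
  have -> : psi x * expR y = expR (- ((1 - eps) * (x ^+ 2 / 2))).
    by rewrite /psi -expRD yE; congr expR; ring.
  rewrite expRN ler_pdivlMr ?expR_gt0 //; exact: le_trans up L0m.
have lo' : L 0 * (psi x * (1 - y)) <= L x.
  apply: le_trans lo; rewrite ler_wpM2l //.
  have -> : - (1 + eps) * (x ^+ 2 / 2) = - (x ^+ 2 / 2) + - y by rewrite yE; ring.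
  by rewrite expRD ler_pM2l //; have := expR_ge1Dx (- y).
have [|d2 _] := profile_defect P d0 d1 (lexx 0); first lra.
rewrite addr0 mulr1 in d2.
rewrite ler_norml; apply/andP; split.
  have h1 : psi x * y * L 0 <= psi x * (256 * tau).
    rewrite -mulrA ler_pM2l // -[leRHS]mulr1; apply: ler_pM => //; lra.
  have h2 : d * m 0 * psi x <= tau * psi x.
    by rewrite ler_pM2r //; apply: le_trans dtau; rewrite ler_piMr // ltW.
  have h3 := ler_wpM2r (ltW p0) d2.
  have h4 : 0 <= E * (tau * psi x).
    by rewrite (mulr_ge0 (ltW E0)) // (mulr_ge0 tau0) // ltW.
  have h5 : 0 <= tau * psi x by rewrite (mulr_ge0 tau0) // ltW.
  lra.
have h1 : (1 + eps) * L x <= (1 + eps) * (m 0 * (psi x * expR y)).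
  by apply: ler_wpM2l => //; lra.
have h2 : (1 + eps) * (m 0 * (psi x * expR y)) <=
    (1 + eps) * (m 0 * (psi x * (1 + 256 * tau * E))).
  by apply: ler_wpM2l; [lra|apply: ler_wpM2l => //; apply: ler_wpM2l => //; exact: ltW].
have h3 : (1 + eps) * (1 + 256 * tau * E) - 1 <= (512 + 384 * E) * tau.
  have : eps * (tau * E) <= 2^-1 * (tau * E).
    by apply: ler_wpM2r => //; rewrite (mulr_ge0 tau0) // ltW.
  lra.
have h5 : 0 <= (512 + 384 * E) * tau.
  by apply: mulr_ge0 tau0; lra.
have h4 : m 0 * psi x * ((1 + eps) * (1 + 256 * tau * E) - 1) <=
    1 * psi x * ((512 + 384 * E) * tau).
  apply: (@le_trans _ _ (m 0 * psi x * ((512 + 384 * E) * tau))).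
    by rewrite ler_wpM2l // mulr_ge0 // ltW.
  by rewrite ler_wpM2r // ler_wpM2r // ltW.
lra.
Qed.

(** Of the exponent b ^+ 2 / 2, one quarter pays for psi x and the rest for a factor
b ^- 3, that is d / 96. *)
Lemma psi_far (R : realType) (d b x : R) : 0 <= x -> 1 <= b -> 2 * x <= b ->
  d * b ^+ 3 = 96 -> psi b <= d * psi x.
Proof.
move=> x0 b1 xb db.
have b0 : 0 < b by rewrite (lt_le_trans ltr01).
have b3 : 0 < b ^+ 3 by rewrite exprn_gt0.
have xb2 : x ^+ 2 / 2 <= b ^+ 2 / 8.
  have : (2 * x) ^+ 2 <= b ^+ 2 by rewrite lerXn2r ?nnegrE ?mulr_ge0 // ltW.
  by rewrite exprMn; lra.
set y := 3 * b ^+ 2 / 8.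
have y0 : 0 <= y by rewrite /y; have := sqr_ge0 b; lra.
have h1 : psi b <= psi x * expR (- y).
  by rewrite /psi -expRD ler_expR /y; lra.
apply: le_trans h1 _; rewrite mulrC ler_pM2r ?psi_gt0 //.
rewrite expRN -[leLHS]mul1r ler_pdivrMr ?expR_gt0 //.
have h2 := expR_ge1Dxn 1 y0.
have h3 : y ^+ 2 / 2 = 9 / 128 * (b ^+ 3 * b) by rewrite /y; field.
have h4 : b ^+ 3 <= b ^+ 3 * b by rewrite ler_peMr // ltW.
have d0 : 0 <= d.
  by rewrite -(@pmulr_lge0 _ (b ^+ 3)) // db.
have h5 : 9 / 128 * b ^+ 3 <= expR y.
  by apply: le_trans h2; rewrite -[(1.+1)`!%:R]/(2 : R) h3; lra.
have := ler_wpM2l d0 h5; lra.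
Qed.

(** * Comparison of the tails *)

(** The point b is of order d to the power -1/3: far enough for the tails beyond b
to be negligible at x, near enough for profile_m_gaussian to hold up to b. *)
Definition cutoff (R : realType) (d x b : R) : Prop :=
  [/\ 0 <= x, 1 <= b, 2 * x <= b, d * b ^+ 3 = 96 & 256 * d * (1 + b) <= 2^-1].

Lemma cutoff_le (R : realType) (d x b s : R) : 0 < d -> cutoff d x b ->
  0 <= s -> s <= b -> 256 * d * (1 + s) <= 2^-1 /\ d * s ^+ 3 <= 96.
Proof.
move=> d0 [x0 b1 xb db eb] s0 sb; split.
  by have := ler_wpM2l (ltW d0) sb; lra.
by rewrite -db ler_wpM2l ?(ltW d0) // lerXn2r ?nnegrE // (le_trans s0).
Qed.

Lemma integrate_cubic (R : realType) (F : R -> R) (D K x b : R) :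
  0 <= x -> x <= b -> 0 <= D -> 0 <= K ->
  (forall s t, x <= s -> s <= t -> t <= b ->
     F t - F s <= (t - s) * (D * ((1 + s ^+ 3) * psi s)) + K * (t - s) ^+ 2) ->
  F b - F x <= 8 * D * ((1 + x ^+ 2) * psi x).
Proof.
move=> x0 xb D0 K0 hF.
(* - (p psi)' is 2 D (u^3 - u^2 + 2 u + 1) psi, at least D (1 + u^3) psi *)
pose p : {poly R} := (2 * D) *: ('X^2 - 'X + 4%:P).
have pE u : p.[u] = 2 * D * (u ^+ 2 - u + 4) by rewrite /p !hornerE.
have qE u : ('X * p - p^`()).[u] = 2 * D * (u ^+ 3 - u ^+ 2 + 2 * u + 1).
  by rewrite /p !poly.derivE !hornerE /GRing.scale /=; ring.
have b0 := le_trans x0 xb.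
have quad (u : R) : 0 <= u ^+ 2 - u + 4.
  by have := sqr_ge0 (u - 1); have := sqr_ge0 u; lra.
apply: (@le_trans _ _ (p.[x] * psi x - p.[b] * psi b)).
  apply: (integrate_poly_psi xb K0) => s t xs st tb.
  apply: le_trans (hF _ _ xs st tb) _; rewrite lerD2r.
  apply: ler_wpM2l; first by rewrite subr_ge0.
  rewrite qE mulrA; apply: ler_wpM2r; first exact: ltW (psi_gt0 s).
  rewrite -mulrA mulrCA ler_wpM2l //.
  have s0 := le_trans x0 xs.
  have := sqr_ge0 (s - 1); have := mulr_ge0 s0 (sqr_ge0 (s - 1)).
  have := exprn_ge0 3 s0; lra.
have h1 : 0 <= p.[b] * psi b.
  rewrite pE; apply: mulr_ge0; last exact: ltW (psi_gt0 b).
  by apply: mulr_ge0 (quad b); lra.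
have h2 : p.[x] * psi x <= 8 * D * ((1 + x ^+ 2) * psi x).
  rewrite [leRHS]mulrA; apply: ler_wpM2r; first exact: ltW (psi_gt0 x).
  have := mulr_ge0 D0 x0; have := mulr_ge0 D0 (sqr_ge0 x); rewrite pE; lra.
lra.
Qed.

(** Both H and m 0 * gtail are primitives up to sign, of m and of m 0 * psi, and these
differ by O(d (1 + u ^+ 3)) psi u up to b; beyond b both tails are O(d psi x). *)
Lemma profile_H_gaussian (R : realType) : exists2 K : R, 0 < K &
  forall (d : R) (m H L G : R -> R) (x b : R),
  tail_profile d m H L G -> 0 < d -> d <= 384^-1 -> cutoff d x b ->
  `|H x - m 0 * gtail x| <= K * d * ((1 + x ^+ 2) * psi x).
Proof.
have [K K0 mK] := profile_m_gaussian R.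
exists (8 * K + (32 * (1 + 97 * K) + 1)); first lra.
move=> d m H L G x b P d0 d1 cut; have [x0 b1 xb2 db eb] := cut.
have d0' := ltW d0.
have b0 : 0 <= b by lra.
have xb : x <= b by lra.
have m00 := profile_m_ge0 P (lexx 0); have m01 := profile_m0_le P.
have [K1 K10 lip1] := poly_psi_lipschitz (1 : {poly R}) x b.
have [K2 K20 lip2] := poly_psi_lipschitz (1 + 'X^3 : {poly R}) x b.
have hX u : (1 + 'X^3 : {poly R}).[u] = 1 + u ^+ 3.
  by rewrite hornerD hornerXn hornerC.
have mg s : x <= s -> s <= b ->
    `|m s - m 0 * psi s| <= K * d * ((1 + s ^+ 3) * psi s).
  move=> xs sb; have s0 := le_trans x0 xs.
  have [e1 e2] := cutoff_le d0 cut s0 sb.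
  by have := mK _ _ _ _ _ _ P d0 d1 s0 e1 e2; rewrite !mulrA.
have D0 : 0 <= K * d by rewrite mulr_ge0 // ltW.
have psi_diff s t : x <= s -> s <= t -> t <= b -> `|m 0 * (psi t - psi s)| <= K1 * (t - s).
  move=> xs st tb; rewrite normrM ger0_norm //.
  have := lip1 _ _ xs st tb; rewrite !hornerE => h; apply: le_trans h.
  by rewrite ler_piMl.
have up : (- H b + m 0 * gtail b) - (- H x + m 0 * gtail x) <=
    8 * (K * d) * ((1 + x ^+ 2) * psi x).
  apply: (@integrate_cubic _ (fun u => - H u + m 0 * gtail u) _ K1) => // s t xs st tb.
  have s0 := le_trans x0 xs; have ts : 0 <= t - s by rewrite subr_ge0.
  have [_ h1] := profile_H_incr P s0 st.
  have [h2 _] := gtail_increment s0 st.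
  have := mg s xs (le_trans st tb); rewrite ler_norml => /andP[_ /(ler_wpM2l ts) h3].
  have := psi_diff _ _ xs st tb; rewrite ler_norml => /andP[/(ler_wpM2l ts) h4 _].
  have h5 := ler_wpM2l m00 h2.
  lra.
have lo : (H b - m 0 * gtail b) - (H x - m 0 * gtail x) <=
    8 * (K * d) * ((1 + x ^+ 2) * psi x).
  apply: (@integrate_cubic _ (fun u => H u - m 0 * gtail u) _ (K1 + K * d * K2)) => //.
    by rewrite addr_ge0 // mulr_ge0.
  move=> s t xs st tb.
  have s0 := le_trans x0 xs; have ts : 0 <= t - s by rewrite subr_ge0.
  have [h1 _] := profile_H_incr P s0 st.
  have [_ h2] := gtail_increment s0 st.
  have := mg t (le_trans xs st) tb; rewrite ler_norml => /andP[/(ler_wpM2l ts) h3 _].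
  have := psi_diff _ _ xs st tb; rewrite ler_norml => /andP[/(ler_wpM2l ts) h4 _].
  have := lip2 _ _ xs st tb; rewrite !hX ler_norml => /andP[_ h6].
  have h7 := ler_wpM2l (mulr_ge0 ts D0) h6.
  have h5 := ler_wpM2l m00 h2.
  lra.
have psib := psi_far x0 b1 xb2 db.
have gb : gtail b <= d * psi x by apply: le_trans psib; exact: gtail_le.
have Hb : H b <= 32 * (1 + 97 * K) * (d * psi x).
  have [|_ h1] := profile_defect P d0 d1 b0; first by have := mulr_ge0 d0' b0; lra.
  apply: le_trans h1 _; rewrite -mulrA ler_pM2l //.
  have [e1 e2] := cutoff_le d0 cut b0 (lexx b).
  have := mK _ _ _ _ _ _ P d0 d1 b0 e1 e2; rewrite ler_norml => /andP[_ h2].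
  have pb := psi_gt0 b.
  have h3 : K * (d * (1 + b ^+ 3)) * psi b <= 97 * K * psi b.
    apply: ler_wpM2r; first exact: ltW.
    rewrite mulrC; apply: ler_wpM2r; [exact: ltW|lra].
  have h4 : m 0 * psi b <= psi b by rewrite ler_piMl // ltW.
  have h5 : (1 + 97 * K) * psi b <= (1 + 97 * K) * (d * psi x).
    by apply: ler_wpM2l => //; lra.
  lra.
have Hb0 := profile_H_ge0 P b0.
have gb0 := gtail_ge0 b.
have mgb : m 0 * gtail b <= d * psi x.
  by apply: le_trans gb; rewrite ler_piMl.
have mgb0 := mulr_ge0 m00 gb0.
have dp0 : 0 <= d * psi x by rewrite mulr_ge0 // ltW // psi_gt0.
have dpx : 0 <= d * psi x * x ^+ 2 by rewrite mulr_ge0 // sqr_ge0.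
have Kx : 0 <= K * (d * psi x * x ^+ 2) by rewrite mulr_ge0 // ltW.
have Kd : 0 <= K * (d * psi x) by rewrite mulr_ge0 // ltW.
by rewrite ler_norml; apply/andP; split; lra.
Qed.

(** Here m', H', L' and G' belong to - W. *)
Lemma profile_moderate_deviation (R : realType) : exists2 K : R, 0 < K &
  forall (d : R) (m H L G m' H' L' G' : R -> R) (x b : R),
  tail_profile d m H L G -> tail_profile d m' H' L' G' ->
  m' 0 = m 0 -> H 0 + H' 0 = 1 ->
  0 < d -> d <= 384^-1 -> cutoff d x b ->
  `|G x - (1 - Phi x)| <= K * d * (1 + x ^+ 3) * (1 - Phi x).
Proof.
have [K K0 HK] := profile_H_gaussian R.
have [M M0 mM] := profile_m_gaussian R.
have k0 := peak_gt0 R; have g0E := gtail0 R; have PhiE := @gtailE R.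
move: (normal_peak 1) k0 g0E PhiE => k k0 g0E PhiE.
have e0 : 0 < expR (3 / 2 : R) by exact: expR_gt0.
have psiE := @gtail_ge R; move: (expR (3 / 2)) e0 psiE => e e0 psiE.
exists ((4 * e * K + 2 * K * k + 64 * (1 + 97 * M) * (4 * e)) / k).
  apply: (divr_gt0 _ k0); have := mulr_gt0 e0 K0; have := mulr_gt0 K0 k0.
  by have := mulr_gt0 M0 e0; lra.
move=> d m H L G m' H' L' G' x b P P' m'E HH' d0 d1 cut.
have [x0 b1 xb2 db eb] := cut.
have cut0 : cutoff d 0 b by split => //; lra.
have d0' := ltW d0.
have xb : x <= b by lra.
have xd : x <= x + d by rewrite lerDl.
have [e1 e2] := cutoff_le d0 cut x0 xb.
have dx2 : d * (x + 2) <= 128^-1 by have := mulr_ge0 d0' x0; lra.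
have g0 := gtail_ge0 x.
rewrite PhiE; set g := gtail x in g0 *.
have q0 : 0 <= 1 + x ^+ 3 by rewrite addr_ge0 ?exprn_ge0.
pose T := d * (1 + x ^+ 3) * g.
have dpsi : d * ((1 + x ^+ 2) * psi x) <= 4 * e * T.
  have [_ [_ c3]] := cube_bounds x0.
  have h1 : (1 + x ^+ 2) * psi x <= (1 + x ^+ 2) * (e * ((1 + x) * g)).
    by apply: ler_wpM2l; [rewrite addr_ge0 // sqr_ge0|exact: psiE].
  have h2 := ler_wpM2r (mulr_ge0 (ltW e0) g0) c3.
  have h3 := ler_wpM2l d0' (le_trans h1 (_ : _ <= 4 * e * ((1 + x ^+ 3) * g))).
  by rewrite /T; have : d * ((1 + x ^+ 2) * psi x) <= d * (4 * e * ((1 + x ^+ 3) * g));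
    [apply: h3; lra|lra].
(* the estimates of H 0 and H' 0 add up to 1 = 2 m 0 gtail 0 + O(d), and
   gtail 0 = (2 k)^-1 *)
have norm : `|k - m 0| <= 2 * K * d * k.
  have := HK _ _ _ _ _ _ _ P d0 d1 cut0.
  have := HK _ _ _ _ _ _ _ P' d0 d1 cut0.
  have -> : psi (0 : R) = 1 by rewrite /psi expr0n /= mul0r oppr0 expR0.
  rewrite m'E g0E expr0n /= addr0 !mulr1 !ler_norml => /andP[h1 h2] /andP[h3 h4].
  have h5 : m 0 * (2 * k)^-1 * (2 * k) = m 0.
    by rewrite mulfVK // gt_eqF // mulr_gt0.
  have k20 : 0 <= 2 * k by lra.
  set u := m 0 * (2 * k)^-1 in h1 h2 h3 h4 h5.
  have h6 : - (2 * K * d) <= 1 - 2 * u by lra.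
  have h7 : 1 - 2 * u <= 2 * K * d by lra.
  have := ler_wpM2r (ltW k0) h6; have := ler_wpM2r (ltW k0) h7.
  by move=> h8 h9; apply/andP; split; lra.
have Hx := HK _ _ _ _ _ _ _ P d0 d1 cut; rewrite -/g in Hx.
have KT : K * d * ((1 + x ^+ 2) * psi x) <= K * (4 * e * T).
  by rewrite -mulrA ler_pM2l.
have gT : d * g <= T.
  by rewrite /T ler_wpM2r // ler_peMr // lerDl exprn_ge0.
have normg : `|(k - m 0) * g| <= 2 * K * k * T.
  rewrite normrM (ger0_norm g0); apply: le_trans (ler_wpM2r g0 norm) _.
  have -> : 2 * K * d * k * g = 2 * K * k * (d * g) by ring.
  by apply: ler_wpM2l => //; rewrite !mulr_ge0 // ltW.
have px := psi_gt0 x.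
have mx : m x <= (1 + 97 * M) * psi x.
  have := mM _ _ _ _ _ _ P d0 d1 x0 e1 e2; rewrite ler_norml => /andP[_ h].
  have h1 : M * (d * (1 + x ^+ 3)) * psi x <= M * 97 * psi x.
    by apply: ler_wpM2r; [exact: ltW|rewrite ler_pM2l //; lra].
  have h2 : m 0 * psi x <= psi x.
    by rewrite ler_piMl ?(ltW px) // (profile_m0_le P).
  lra.
have dmx : d * m x <= (1 + 97 * M) * (4 * e * T).
  apply: (@le_trans _ _ (d * ((1 + 97 * M) * psi x))); first by rewrite ler_pM2l.
  rewrite mulrCA ler_pM2l; last lra.
  apply: le_trans dpsi; rewrite ler_pM2l // ler_peMl ?(ltW px) // lerDl.
  exact: sqr_ge0.
have mv := profile_ratio P d0 d1 x0 dx2.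
have mx0 := profile_m_ge0 P x0.
have dm0 : 0 <= d * m x by rewrite mulr_ge0.
have Gup : G x <= H x + 64 * (d * m x).
  have := profile_G_le P x0 (erefl _); set v := Num.max (x - d) 0 in mv *.
  have v0 : 0 <= v by rewrite le_max lexx orbT.
  have vx : v <= x by rewrite ge_max x0 andbT gerBl.
  have xv : x - v <= d.
    have : x - d <= v by rewrite le_max lexx.
    lra.
  have [_ h1] := profile_H_incr P v0 vx.
  have h2 := ler_wpM2r (profile_m_ge0 P v0) xv.
  have h3 := ler_wpM2l d0' mv.
  lra.
have Glo : H x - d * m x <= G x.
  have [_ h1] := profile_H_incr P x0 xd.
  have := profile_G_ge P x0; lra.
have -> : (4 * e * K + 2 * K * k + 64 * (1 + 97 * M) * (4 * e)) / k * d *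
    (1 + x ^+ 3) * (k * g) =
    (4 * e * K + 2 * K * k + 64 * (1 + 97 * M) * (4 * e)) * T.
  by rewrite /T; field; rewrite gt_eqF.
move: Hx normg; rewrite !ler_norml => /andP[h1 h2] /andP[h3 h4].
by apply/andP; split; lra.
Qed.

Lemma cutoff_exists (R : realType) (d x : R) : 0 < d -> d <= (2 ^+ 20)^-1 ->
  0 <= x -> d * x ^+ 3 <= 12 -> exists b, cutoff d x b.
Proof.
move=> d0 d1 x0 dx.
(* 96 = 12 * 2^3 turns d x^3 <= 12 into 2 x <= b *)
pose b := (96 / d) `^ (3%:R^-1).
have b0 : 0 <= b by exact: powR_ge0.
have b3 : b ^+ 3 = 96 / d.
  rewrite -powR_mulrn // /b -powRrM mulVf ?powRr1 //; first by rewrite divr_ge0 // ltW.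
have db : d * b ^+ 3 = 96 by rewrite b3 mulrCA divff ?mulr1 // gt_eqF.
have cube (u v : R) : 0 <= v -> v ^+ 3 <= u ^+ 3 -> 0 <= u -> v <= u.
  by move=> v0 + u0; rewrite ler_pXn2r // nnegrE.
exists b; split => //.
- apply: (@cube _ _ ler01) => //; rewrite expr1n b3 ler_pdivlMr // mul1r.
  apply: le_trans d1 _; apply: (@le_trans _ _ 1); last lra.
  by rewrite invf_le1 ?exprn_ege1 ?exprn_gt0 // ler1n.
- apply: cube => //; first by rewrite mulr_ge0 ?ler0n.
  rewrite -(ler_pM2l d0) db exprMn mulrCA; lra.
- have d2 : d <= 1024^-1 * 1024^-1.
    apply: le_trans d1 _.
    by rewrite -invfM (_ : 2 ^+ 20 = 1024 * 1024 :> R) //; ring.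
  have hb : d * b <= 2048^-1.
    apply: cube; [by rewrite mulr_ge0 // ltW| |by rewrite invr_ge0 ler0n].
    have -> : (d * b) ^+ 3 = d * d * (d * b ^+ 3) by ring.
    have := ler_pM (ltW d0) (ltW d0) d2 d2.
    rewrite db; set D := d * d => h.
    lra.
  lra.
Qed.

(** * Uniform random permutations *)

(** The inequality perm_zero_bias for perm_sum a / sigma, by rescaling g and F. *)
Lemma perm_sum_zero_bias (R : realType) (n : nat) (a : 'M[R]_n) (sigma : R) :
  (forall i : 'I_n, \sum_(j < n) a i j = 0) ->
  (forall j : 'I_n, \sum_(i < n) a i j = 0) -> (1 < n)%N -> 0 < sigma ->
  sigma ^+ 2 = mean (fun s : 'S_n => perm_sum a s ^+ 2) ->
  zero_bias_le (fun s : 'S_n => perm_sum a s / sigma) (12 * max_entry a / sigma).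
Proof.
move=> ra ca n1 s0 sE g F gF; have sn0 : sigma != 0 by rewrite gt_eqF.
have f0 : 0 < n`!%:R :> R by rewrite ltr0n fact_gt0.
have gF' : primitive_of (fun t => g (t / sigma)) (fun t => sigma * F (t / sigma)).
  move=> x y xy; have xy' : x / sigma <= y / sigma by rewrite ler_pM2r // invr_gt0.
  have [h1 h2] := gF _ _ xy'.
  have e : y - x = sigma * (y / sigma - x / sigma) by rewrite -mulrBl mulrC divfK.
  by rewrite e -mulrBr -!mulrA !ler_pM2l.
have := perm_zero_bias ra ca n1 gF'.
have -> : \sum_(s : 'S_n) perm_sum a s ^+ 2 = sigma ^+ 2 * n`!%:R.
  by rewrite sE /mean card_Sn divfK // gt_eqF.
rewrite /mean card_Sn => h.
rewrite ler_pM2r ?invr_gt0 //.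
have c0 : 0 < n`!%:R * sigma ^+ 2 by rewrite mulr_gt0 // exprn_gt0.
rewrite -(ler_pM2l c0); apply: le_trans (_ : _ <= n`!%:R * \sum_(s : 'S_n)
  perm_sum a s * (sigma * F (perm_sum a s / sigma))) _.
  rewrite -mulrA ler_pM2l // mulr_sumr; apply: ler_sum => s _.
  by rewrite le_eqVlt; apply/orP; left; apply/eqP; field.
apply: le_trans h _; rewrite [sigma ^+ 2 * _]mulrC ler_pM2l //.
by apply: ler_sum => s _; rewrite -mulrDl.
Qed.

Lemma perm_sum_size_le1 (R : realType) (n : nat) (a : 'M[R]_n) (s : 'S_n) :
  (forall i : 'I_n, \sum_(j < n) a i j = 0) -> (n <= 1)%N -> perm_sum a s = 0.
Proof.
move=> ra n1; have I1 (i : 'I_n) : i = 0%N :> nat.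
  by apply/eqP; rewrite -leqn0 -ltnS (leq_trans (ltn_ord i)).
rewrite /perm_sum big1 // => i _; rewrite -(ra i) (big_pred1 (s i)) // => j.
by rewrite /= -val_eqE /= !I1.
Qed.

Lemma perm_sum_max_entry0 (R : realType) (n : nat) (a : 'M[R]_n) (s : 'S_n) :
  max_entry a = 0 -> perm_sum a s = 0.
Proof.
move=> c0; rewrite /perm_sum big1 // => i _; apply/eqP.
by rewrite -normr_le0 -c0 le_max_entry.
Qed.

Lemma uniform_perm_integral (d : measure_display) (T : measurableType d)
    (R : realType) (P : probability T R) (n : nat) (pi : T -> 'S_n) (f : 'S_n -> R) :
  uniform_random_perm P pi -> (forall s, 0 <= f s) ->
  (\int[P]_w (f (pi w))%:E)%E = (mean f)%:E.
Proof.
move=> upi f0.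
pose A s := [set w | pi w = s].
have mA s : measurable (A s) by have [] := upi s.
have PA s : P (A s) = (n`!%:R^-1)%:E by have [] := upi s.
transitivity (\int[P]_w (\sum_(s : 'S_n) ((f s)%:E * (\1_(A s) w)%:E)))%E.
  apply: eq_integral => w _; rewrite (bigD1 (pi w)) //= big1 => [|s sw].
    by rewrite indicE mem_set // mule1 adde0.
  by rewrite indicE memNset ?mule0 // => /esym /eqP; rewrite (negbTE sw).
have mind s : measurable_fun setT (fun w => (\1_(A s) w)%:E : \bar R).
  by apply/measurable_EFinP; exact: measurable_indic.
rewrite ge0_integral_sum //=; last 2 first.
- by move=> s; apply: emeasurable_funM => //; exact: measurable_cst.
- by move=> s w _; rewrite mule_ge0 ?lee_fin.
rewrite /mean card_Sn mulr_suml -sumEFin; apply: eq_bigr => s _.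
rewrite ge0_integralZl_EFin //.
rewrite integral_indic // setIT.
by transitivity ((f s)%:E * P (A s))%E; last rewrite PA.
Qed.

Lemma uniform_perm_expectation (d : measure_display) (T : measurableType d)
    (R : realType) (P : probability T R) (n : nat) (pi : T -> 'S_n) (f : 'S_n -> R) :
  uniform_random_perm P pi -> (forall s, 0 <= f s) ->
  ('E_P[fun w => f (pi w)] = (mean f)%:E)%E.
Proof. by move=> upi f0; rewrite unlock; exact: uniform_perm_integral. Qed.

Lemma uniform_perm_prob (d : measure_display) (T : measurableType d)
    (R : realType) (P : probability T R) (n : nat) (pi : T -> 'S_n)
    (f : 'S_n -> R) (x : R) :
  uniform_random_perm P pi ->
  P [set w | x <= f (pi w)] = (upper_tail f x)%:E.
Proof.
move=> upi; rewrite -(uniform_perm_integral upi) //.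
have -> : [set w | x <= f (pi w)] = \bigcup_(s in [set s | x <= f s]) [set w | pi w = s].
  by apply/seteqP; split => w /=; [exists (pi w)|move=> [s /= xs ->]].
set B := \bigcup_(_ in _) _.
have mB : measurable B.
  by apply: fin_bigcup_measurable => [|s _]; [exact: finite_finset|have [] := upi s].
transitivity (\int[P]_w (\1_B w)%:E)%E; first by rewrite integral_indic // setIT.
apply: eq_integral => w _; rewrite indicE.
have -> // : (w \in B) = (x <= f (pi w)).
by apply/idP/idP => [/set_mem [s /= xs ->]//|xw]; apply/mem_set; exists (pi w).
Qed.

(** When d is bounded below, x is bounded above, and so 1 - Phi x is bounded below. *)
Lemma deviation_bound_large_d (R : realType) : exists2 C : R, 0 < C &
  forall d x G : R, (2 ^+ 20)^-1 <= d -> 0 <= x -> d * x ^+ 3 <= 12 ->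
    0 <= G -> G <= 1 ->
    `|G - (1 - Phi x)| <= C * d * (1 + x ^+ 3) * (1 - Phi x).
Proof.
have [N N0 NE] : exists2 N : R, 0 < N & N = 2 ^+ 20.
  by exists (2 ^+ 20); [exact: exprn_gt0|].
rewrite -NE; clear NE.
pose X := 1 + 12 * N.
have X0 : 0 <= X by rewrite /X; lra.
have k0 := peak_gt0 R.
pose q0 := 1 - Phi X.
have q00 : 0 < q0 by rewrite /q0 gtailE mulr_gt0 // gtail_gt0.
exists (N / q0); first by rewrite divr_gt0.
move=> d x G dN x0 dx G0 G1.
have Nd : 1 <= N * d.
  have := ler_wpM2l (ltW N0) dN; rewrite divff // gt_eqF //.
have x30 : 0 <= x ^+ 3 by rewrite exprn_ge0.
have xX : x <= X.
  have [x1|/ltW x1] := leP x 1; first by rewrite /X; lra.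
  have h1 : x <= x ^+ 3 by rewrite -[leLHS]expr1 ler_weXn2l.
  have h2 : 1 * x ^+ 3 <= N * d * x ^+ 3 by apply: ler_wpM2r.
  have h3 := ler_wpM2l (ltW N0) dx.
  by rewrite /X; lra.
have qx : q0 <= 1 - Phi x.
  have [h _] := Phi_increment x0 xX.
  have : 0 <= (X - x) * (normal_peak 1 * psi X).
    by rewrite mulr_ge0 ?subr_ge0 // mulr_ge0 ?(ltW k0) // ltW // psi_gt0.
  rewrite /q0; lra.
have Phi_ge0 : 0 <= Phi x by rewrite /Phi fine_ge0.
have q1 : 1 - Phi x <= 1 by lra.
set q := 1 - Phi x in qx q1 *.
apply: (@le_trans _ _ 1).
  by rewrite ler_norml; apply/andP; split; lra.
have h1 : 1 <= q / q0 by rewrite ler_pdivlMr // mul1r.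
have h2 : 1 <= N * d * (1 + x ^+ 3).
  by rewrite mulr_ege1 // lerDl.
have -> : N / q0 * d * (1 + x ^+ 3) * q = (N * d * (1 + x ^+ 3)) * (q / q0) by ring.
by rewrite mulr_ege1.
Qed.

Theorem mainTheorem3 (R : realType) :
  exists C : R,
  forall (d : measure_display) (T : measurableType d) (P : probability T R)
    (n : nat) (a : 'M[R]_n) (pi : T -> 'S_n) (sigma : R),
  (forall i : 'I_n, \sum_(j < n) a i j = 0) ->
  (forall j : 'I_n, \sum_(i < n) a i j = 0) ->
  uniform_random_perm P pi ->
  0 < sigma ->
  (sigma ^+ 2)%:E = ('E_P[fun w : T => (perm_sum a (pi w) ^+ 2)%R])%E ->
  let c0 : R := max_entry a in
  let W : T -> R := fun w => perm_sum a (pi w) / sigma in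
  forall x : R, 0 <= x -> x <= (sigma / c0) `^ (3%:R^-1) ->
  exists theta : R, `|theta| <= C /\
    fine (P [set w : T | x <= W w]) / (1 - Phi x) =
      1 + theta * (1 + x ^+ 3) * c0 / sigma.
Proof.
have [K K0 HK] := profile_moderate_deviation R.
have [K' K'0 HK'] := deviation_bound_large_d R.
exists (12 * (K + K')) => d T P n a pi sigma ra ca upi s0 s2 c0 W x x0 xle.
have sE : sigma ^+ 2 = mean (fun s : 'S_n => perm_sum a s ^+ 2).
  apply: EFin_inj; rewrite s2.
  by rewrite (uniform_perm_expectation (f := fun s => perm_sum a s ^+ 2) upi) // => s; exact: sqr_ge0.
have nz : ~ (forall s : 'S_n, perm_sum a s = 0).
  move=> S0; have := exprn_gt0 2 s0; rewrite sE /mean big1 ?mul0r ?ltxx // => s _.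
  by rewrite S0 expr0n.
have n1 : (1 < n)%N.
  by rewrite ltnNge; apply/negP => n1; apply: nz => s; exact: perm_sum_size_le1.
have c_gt0 : 0 < c0.
  rewrite lt_neqAle bigmax_ge_id andbT eq_sym; apply/eqP => c00.
  by apply: nz => s; exact: perm_sum_max_entry0.
have card0 : (0 < #|{: 'S_n}|)%N by rewrite card_Sn fact_gt0.
pose V (s : 'S_n) := perm_sum a s / sigma.
set G := fine _.
have GE : G = upper_tail V x.
  by rewrite /G (uniform_perm_prob V x upi).
pose dl := 12 * c0 / sigma.
have dl0 : 0 < dl by rewrite /dl divr_gt0 // mulr_gt0.
have zW : zero_bias_le V dl by exact: perm_sum_zero_bias.
have zWN : zero_bias_le (fun s => - V s) dl.
  have raN i : \sum_(j < n) (- a) i j = 0.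
    by under eq_bigr do rewrite mxE; rewrite sumrN ra oppr0.
  have caN j : \sum_(i < n) (- a) i j = 0.
    by under eq_bigr do rewrite mxE; rewrite sumrN ca oppr0.
  have := perm_sum_zero_bias raN caN n1 s0; rewrite max_entryN -/c0 -/dl.
  have -> : (fun s : 'S_n => perm_sum (- a) s / sigma) = (fun s => - V s).
    by apply/funext => s; rewrite perm_sumN mulNr.
  by apply; rewrite sE; apply: eq_mean => s; rewrite perm_sumN sqrrN.
have dx3 : dl * x ^+ 3 <= 12.
  have h : x ^+ 3 <= sigma / c0.
    have -> : sigma / c0 = ((sigma / c0) `^ (3%:R^-1)) ^+ 3.
      rewrite -powR_mulrn ?powR_ge0 // -powRrM mulVf ?powRr1 //.
      by rewrite divr_ge0 // ltW.
    by rewrite lerXn2r ?nnegrE ?powR_ge0.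
  apply: le_trans (ler_wpM2l (ltW dl0) h) _.
  by rewrite le_eqVlt; apply/orP; left; apply/eqP; rewrite /dl; field; rewrite !gt_eqF.
have x30 : 0 <= x ^+ 3 by rewrite exprn_ge0.
set q := 1 - Phi x.
have q0 : 0 < q by rewrite /q gtailE mulr_gt0 ?peak_gt0 ?gtail_gt0.
have bound : `|G - q| <= (K + K') * dl * (1 + x ^+ 3) * q.
  have h0 : 0 <= dl * (1 + x ^+ 3) * q.
    by apply: mulr_ge0 (ltW q0); apply: mulr_ge0 (ltW dl0) _; apply: addr_ge0.
  have hK := mulr_ge0 (ltW K0) h0.
  have hK' := mulr_ge0 (ltW K'0) h0.
  have -> : (K + K') * dl * (1 + x ^+ 3) * q =
    K * (dl * (1 + x ^+ 3) * q) + K' * (dl * (1 + x ^+ 3) * q) by ring.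
  have [big|/ltW small] := leP (2 ^+ 20)^-1 dl.
    apply: (@le_trans _ _ (K' * (dl * (1 + x ^+ 3) * q))); last by rewrite lerDr.
    have -> : K' * (dl * (1 + x ^+ 3) * q) = K' * dl * (1 + x ^+ 3) * q by ring.
    have G0 : 0 <= G by rewrite GE; apply: mean_ge0 => s.
    have G1 : G <= 1.
      by rewrite GE -(mean1 R card0); apply: mean_le => s; case: (x <= V s).
    exact: HK' big x0 dx3 G0 G1.
  have [b cut] := cutoff_exists dl0 small x0 dx3.
  apply: (@le_trans _ _ (K * (dl * (1 + x ^+ 3) * q))); last by rewrite lerDl.
  have -> : K * (dl * (1 + x ^+ 3) * q) = K * dl * (1 + x ^+ 3) * q by ring.
  rewrite GE.
  have dl1 : dl <= 384^-1.
    move: small; have -> : (2 : R) ^+ 20 = 1024 * 1024 by ring.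
    by rewrite invfM; lra.
  have dl1' : dl <= 1 by lra.
  have zWNN : zero_bias_le (fun s => - - V s) dl.
    by move=> g F gF; have := zW g F gF; congr (_ <= _); apply: eq_mean => s; rewrite opprK.
  apply: (HK dl _ _ _ _ _ _ _ _ x b
    (zero_bias_profile card0 dl0 dl1' zW zWN)
    (zero_bias_profile card0 dl0 dl1' zWN zWNN)) => //.
    by rewrite tail_mean_opp0 // (mean_eq0 zW zWN).
  by rewrite star_tail_opp0 (mean_sqr1 card0 zW zWN).
have t0 : 0 < (1 + x ^+ 3) * c0 / sigma.
  by rewrite divr_gt0 // mulr_gt0 // ltr_pwDl.
exists ((G / q - 1) / ((1 + x ^+ 3) * c0 / sigma)); split; last first.
  have -> : (G / q - 1) / ((1 + x ^+ 3) * c0 / sigma) * (1 + x ^+ 3) * c0 / sigma =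
    G / q - 1.
    move: (1 + x ^+ 3) t0 => y t0; have y0 : y != 0.
      by apply/eqP => yE; move: t0; rewrite yE !mul0r ltxx.
    by field; rewrite y0 !gt_eqF.
  by rewrite addrC subrK.
rewrite normrM normfV [in X in _ / X]gtr0_norm // ler_pdivrMr //.
have -> : G / q - 1 = (G - q) / q by rewrite mulrBl divff // gt_eqF.
rewrite normrM normfV (gtr0_norm q0) ler_pdivrMr //.
apply: le_trans bound _.
by rewrite le_eqVlt; apply/orP; left; apply/eqP; rewrite /dl; field; rewrite gt_eqF.
Qed.
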